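(* Let $\mathcal{F}=\{f_1,\ldots,f_n\}$ be a system with turning points $c_1<\cdots<c_{l+1}$, and let $$s=\limsup_{m\to\infty}\ell(m)^{1/m},\qquad s_0=\max_{c_i}\limsup_{m\to\infty}\ell'_{c_i}(m)^{1/m}.$$ If $s_0<s$, then the power series $L(t)=\sum_{m\ge1}\ell(m)t^{m-1}$ extends to a meromorphic function on $\{t\in\mathbb{C}:|t|<1/s_0\}$ with a pole at $t=1/s$. Moreover, the kneading determinant $D$ of $\mathcal{F}$ vanishes at $t=1/s$ and has no zero in the open disk $|t|<1/s$.
   Context: **Systems.** A system is a finite family $\mathcal{F}=\{f_1,\ldots,f_n\}$ of continuous strictly monotone functions $f_i:I_i\to\mathbb{R}$, where each $I_i$ is a compact interval with more than one point. The endpoints of the $I_i$ are called turning points; listed without repetition in increasing order they are $c_1<\cdots<c_{l+1}$. $S$ is the free semigroup (with identity $e$) generated by $a_1,\ldots,a_n$, with word length $|\cdot|$. For $g=a_{i_1}\cdots a_{i_m}\in S$ put $f_g=f_{i_m}\circ\cdots\circ f_{i_1}$ with its natural domain $\mathrm{Dom}(f_g)$ (possibly empty), $f_e=\mathrm{Id}_{\mathbb{R}}$. $\sigma(f_i)=1$ if $f_i$ is increasing, $-1$ if decreasing, and $\sigma(f_g)=\sigma(f_{i_1})\cdots\sigma(f_{i_m})$, $\sigma(f_e)=1$. **Counting.** $\ell(m)=\#\{g\in S:|g|=m,\ \mathrm{int}(\mathrm{Dom}(f_g))\ne\emptyset\}$, and for a turning point $c$, $\ell'_c(m)=\#\{g\in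 S:|g|=m,\ \mathrm{int}(\mathrm{Dom}(f_g))\neq\emptyset,\ c\in\partial\,\mathrm{Dom}(f_g)\}$. If $s_0=0$, $1/s_0$ is read as $\infty$. **Kneading matrix and determinant.** The turning points divide $\mathbb{R}$ into closed intervals $P_0=(-\infty,c_1]$, $P_i=[c_i,c_{i+1}]$ ($1\le i\le l$), $P_{l+1}=[c_{l+1},\infty)$. Let $\mathbf{V}$ be the $\mathbb{Q}$-vector space with basis the formal symbols $P_0,\ldots,P_{l+1}$. Put $D(x)=P_i$ if $x\in P_i$ is not a turning point and $D(c_i)=\frac12(P_{i-1}+P_i)$. For $x\in\mathbb{R}$ let $\mathring S_x=\{g\in S: x\in\mathrm{Dom}(f_g),\ \mathrm{int}(\mathrm{Dom}(f_g))\ne\emptyset\}$ and define the invariant coordinate $$\theta(x)=\sum_{g\in\mathring S_x}\sigma(f_g)D(f_g(x))t^{|g|}\in\mathbf{V}[[t]].$$ With respect to the $t$-adic topology on $\mathbf{V}[[t]]$ the one-sided limits $\theta(x^{\pm})$ of $\theta$ at $x$ from the right ($+$) and left ($-$) exist. The kneading increments are $\vartheta_i=\theta(c_i^+)-\theta(c_i^-)=\sum_{j=0}^{l+1}N_{i,j}P_j$, $N_{i,j}\in\mathbb{Q}[[t]]$, $1\le i\le l+1$. The $(l+1)\times(l+2)$ matrix $\{N_{i,j}\}$ is the kneading matrix; let $\Gamma_0,\ldots,\Gamma_{l+1}$ be its columns. Let $e_j(t)=1-t\sum_{i:\,P_j\subset I_i}\sigma(f_i)$. Then the power series $$D=\frac{(-1)^i}{e_i(t)}\det[\Gamma_0,\ldots,\widehat{\Gamma}_i,\ldots,\Gamma_{l+1}]\in\mathbb{Q}[[t]]$$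 (column $\Gamma_i$ deleted) does not depend on $i\in\{0,\ldots,l+1\}$ and is called the kneading determinant of $\mathcal{F}$. Its series converges for $|t|<1/s_0$, so it is regarded as a holomorphic function there. *)

(* Defs.v *)
From HB Require Import structures.
From mathcomp Require Import all_boot all_order all_algebra.
From mathcomp Require Import all_classical all_reals all_analysis.
From mathcomp Require Import complex.

Set Implicit Arguments.
Unset Strict Implicit.
Unset Printing Implicit Defensive.

Import Order.TTheory GRing.Theory Num.Theory.
Import numFieldNormedType.Exports.

Local Open Scope classical_set_scope.
Local Open Scope ring_scope.

Record fps (K : comNzRingType) := Fps { coefs : nat -> K }.

HB.instance Definition _ (K : comNzRingType) := gen_eqMixin (fps K).
HB.instance Definition _ (K : comNzRingType) := gen_choiceMixin (fps K).

Section FpsRing.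
Variable K : comNzRingType.
Implicit Types a b c : fps K.

Lemma fpsP a b : coefs a =1 coefs b -> a = b.
Proof. by case: a b => [a] [b] /= /funext ->. Qed.

Definition fpsC (x : K) : fps K := Fps (fun m => x *+ (m == 0%N)).
Definition fpsX : fps K := Fps (fun m => (m == 1%N)%:R).

Definition fps_add a b := Fps (fun m => coefs a m + coefs b m).
Definition fps_opp a := Fps (fun m => - coefs a m).
Definition fps_mul a b :=
  Fps (fun m => \sum_(i < m.+1) coefs a i * coefs b (m - i)%N).

Fact fps_addA : associative fps_add.
Proof. by move=> a b c; apply: fpsP => m /=; rewrite addrA. Qed.
Fact fps_addC : commutative fps_add.
Proof. by move=> a b; apply: fpsP => m /=; rewrite addrC. Qed.
Fact fps_add0 : left_id (fpsC 0) fps_add.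
Proof. by move=> a; apply: fpsP => m /=; rewrite mul0rn add0r. Qed.
Fact fps_addN : left_inverse (fpsC 0) fps_opp fps_add.
Proof. by move=> a; apply: fpsP => m /=; rewrite mul0rn addNr. Qed.

HB.instance Definition _ :=
  GRing.isZmodule.Build (fps K) fps_addA fps_addC fps_add0 fps_addN.

Lemma coefs_mul_rev a b m :
  coefs (fps_mul a b) m = \sum_(i < m.+1) coefs a (m - i)%N * coefs b i.
Proof.
rewrite /= (reindex_inj rev_ord_inj) /=.
by apply: eq_bigr => i _; rewrite subSS subKn // -ltnS.
Qed.

Fact fps_mulA : associative fps_mul.
Proof.
move=> a b c; apply: fpsP => m; rewrite [RHS]coefs_mul_rev [LHS]/=.
pose f j k := coefs a j * (coefs b (m - j - k)%N * coefs c k).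
transitivity (\sum_(j < m.+1) \sum_(k < m.+1 | (k <= m - j)%N) f j k).
  apply: eq_bigr => /= j _; have /= -> := coefs_mul_rev b c (m - j)%N.
  rewrite big_distrr /= (big_ord_narrow_leq (leq_subr _ _)).
  by apply: eq_bigr.
rewrite (exchange_big_dep predT) //=; apply: eq_bigr => k _.
transitivity (\sum_(j < m.+1 | (j <= m - k)%N) f j k).
  apply: eq_bigl => j; rewrite -ltnS -(ltnS j) -!subSn ?leq_ord //.
  by rewrite -subn_gt0 -(subn_gt0 j) -!subnDA addnC.
rewrite (big_ord_narrow_leq (leq_subr _ _)) big_distrl /=.
by apply: eq_bigr => j _; rewrite /f -!mulrA -!subnDA addnC.
Qed.

Fact fps_mulC : commutative fps_mul.
Proof.
move=> a b; apply: fpsP => m; rewrite coefs_mul_rev /=.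
by apply: eq_bigr => i _; rewrite mulrC.
Qed.

Fact fps_mul1 : left_id (fpsC 1) fps_mul.
Proof.
move=> a; apply: fpsP => m /=; rewrite big_ord_recl /= mul1r subn0.
by rewrite big1 ?addr0 // => i _; rewrite mul0r.
Qed.

Fact fps_mulD : left_distributive fps_mul fps_add.
Proof.
move=> a b c; apply: fpsP => m /=; rewrite -big_split /=.
by apply: eq_bigr => i _; rewrite mulrDl.
Qed.

Fact fps_one_neq0 : fpsC 1 != 0.
Proof.
by apply/eqP => /(congr1 (fun a => coefs a 0%N))/eqP; rewrite /= oner_eq0.
Qed.

HB.instance Definition _ := GRing.Zmodule_isComNzRing.Build (fps K)
  fps_mulA fps_mulC fps_mul1 fps_mulD fps_one_neq0.

Definition fps_unit : {pred fps K} := fun a => `[< exists b, b * a = 1 >].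
Definition fps_inv a := if a \in fps_unit then xget 0 [set b | b * a = 1] else a.

Fact fps_mulV : {in fps_unit, left_inverse 1 fps_inv *%R}.
Proof.
move=> a ua; rewrite /fps_inv ua.
by case/asboolP: ua => b ba; case: xgetP => [_ _ //|/(_ b)].
Qed.

Fact fps_unitP a b : b * a = 1 -> fps_unit a.
Proof. by move=> ba; apply/asboolP; exists b. Qed.

Fact fps_inv_out : {in [predC fps_unit], fps_inv =1 id}.
Proof. by move=> a; rewrite inE /= /fps_inv => /negbTE ->. Qed.

HB.instance Definition _ := GRing.ComNzRing_hasMulInverse.Build (fps K)
  fps_mulV fps_unitP fps_inv_out.

Lemma coefs_mul a b m :
  coefs (a * b) m = \sum_(i < m.+1) coefs a i * coefs b (m - i)%N.
Proof. by []. Qed.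

Lemma coefs_mulC x a m : coefs (fpsC x * a) m = x * coefs a m.
Proof.
rewrite coefs_mul big_ord_recl /= subn0 big1 ?addr0 // => i _.
by rewrite mul0r.
Qed.

Lemma coefs_mulX a m :
  coefs (fpsX * a) m = if m is m'.+1 then coefs a m' else 0.
Proof.
rewrite coefs_mul; case: m => [|m].
  by rewrite big_ord_recl big_ord0 /= mul0r addr0.
rewrite !big_ord_recl /= mul0r add0r mul1r subSS subn0 big1 ?addr0 // => i _.
by rewrite mul0r.
Qed.

Lemma fps_one_subX_unit (x : K) : 1 - fpsX * fpsC x \is a GRing.unit.
Proof.
pose g := Fps (fun m => x ^+ m).
suff gE : g * (1 - fpsX * fpsC x) = 1.
  by apply/unitrP; exists g; split=> //; rewrite mulrC.
rewrite mulrBr mulr1 [g * _]mulrC -mulrA; apply: fpsP => m.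
rewrite -[LHS]/(coefs g m - coefs (fpsX * (fpsC x * g)) m) coefs_mulX.
by case: m => [|m]; rewrite ?coefs_mulC ?subr0 //= -exprS subrr.
Qed.

End FpsRing.

Record system (R : realType) (n : nat) := System {
  lo : 'I_n -> R;
  hi : 'I_n -> R;
  fn : 'I_n -> R -> R; (* only the values of [fn i] on [`[lo i, hi i]] matter *)
  lo_lt_hi : forall i, lo i < hi i;
  fn_continuous : forall i, {within `[lo i, hi i], continuous (fn i)};
  fn_monotone : forall i,
    {in `[lo i, hi i] &, {homo fn i : x y / x < y}} \/
    {in `[lo i, hi i] &, {homo fn i : x y /~ x < y}}
}.

Section Systems.
Variables (R : realType) (n : nat) (F : system R n).

Definition fn_dom (i : 'I_n) : interval R := `[lo F i, hi F i].

Definition turning_points : seq R :=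
  sort <=%R (undup ([seq lo F i | i : 'I_n] ++ [seq hi F i | i : 'I_n])).

(* The word [:: i1; ...; im] stands for a_{i1}...a_{im}, and
   f_{a_{i1}...a_{im}} = f_{im} \o ... \o f_{i1}: the first letter acts first. *)
Fixpoint word_fn (g : seq 'I_n) (x : R) : R :=
  if g is i :: g' then word_fn g' (fn F i x) else x.

Fixpoint in_dom (g : seq 'I_n) (x : R) : Prop :=
  if g is i :: g' then x \in fn_dom i /\ in_dom g' (fn F i x) else True.

Definition Dom (g : seq 'I_n) : set R := [set x | in_dom g x].

Definition fat (g : seq 'I_n) : Prop := (Dom g)° !=set0.

Definition boundary (A : set R) : set R := closure A `\` A°.

Definition fn_sign (i : 'I_n) : rat :=
  if `[< {in fn_dom i &, {homo fn F i : x y / x < y}} >] then 1 else -1.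

Definition word_sign (g : seq 'I_n) : rat := \prod_(i <- g) fn_sign i.

Definition ell (m : nat) : nat := #|[pred g : m.-tuple 'I_n | `[< fat g >]]|.

Definition ell' (c : R) (m : nat) : nat :=
  #|[pred g : m.-tuple 'I_n | `[< fat g /\ boundary (Dom g) c >]]|.

(* Both root sequences are bounded (by 1 at m = 0 and by n for m >= 1), so the
   real-valued [limn_sup] is their upper limit. *)
Definition growth (u : nat -> nat) : R :=
  limn_sup (fun m => (u m)%:R `^ (m%:R^-1)).

Definition s : R := growth ell.

Definition s0 : R := \big[Num.max/0]_(c <- turning_points) growth (ell' c).

(* l + 1; the i-th entry of [turning_points] (from 0) is c_{i+1} *)
Definition nturn : nat := size turning_points.

Definition cpt (i : nat) : R := nth 0 turning_points i.

Definition Pitv (j : 'I_nturn.+1) : interval R :=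
  Interval (if val j is j'.+1 then BLeft (cpt j') else -oo%O)
           (if (j < nturn)%N then BRight (cpt j) else +oo%O).

(* the vector space V; the formal symbol P_j is [delta_mx 0 j] *)
Definition symV := 'rV[rat]_nturn.+1.

(* c_i belongs to exactly P_{i-1} and P_i, any other point to exactly one P_j *)
Definition Dsym (x : R) : symV :=
  (if x \in turning_points then 2^-1 else 1) *:
  \sum_(j < nturn.+1 | x \in Pitv j) delta_mx 0 j.

(* a series of V[[t]] is its sequence of coefficients *)
Definition theta (x : R) : nat -> symV := fun m =>
  \sum_(g : m.-tuple 'I_n | `[< Dom g x /\ fat g >])
    word_sign g *: Dsym (word_fn g x).

End Systems.

Section Tadic.
Variables (T : Type) (W : zmodType).

(* u y - L belongs to t^N W[[t]] when y is F-close to the limit *)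
Definition tadic_cvg (F : set_system T) (u : T -> nat -> W) (L : nat -> W) :=
  forall N : nat, \forall y \near F, forall m, (m < N)%N -> u y m = L m.

Definition tadic_lim (F : set_system T) (u : T -> nat -> W) : nat -> W :=
  xget (fun=> 0) [set L | tadic_cvg F u L].

End Tadic.

Section Kneading.
Variables (R : realType) (n : nat) (F : system R n).
Local Notation k := (nturn F).

Definition kneading_increment (i : 'I_k) : nat -> symV F := fun m =>
  tadic_lim (at_right (cpt F i)) (theta F) m
  - tadic_lim (at_left (cpt F i)) (theta F) m.

Definition kneading_matrix : 'M[fps rat]_(k, k.+1) :=
  \matrix_(i, j) Fps (fun m => kneading_increment i m 0 j).

Definition e_ser (j : 'I_k.+1) : fps rat :=
  1 - fpsX rat *
      fpsC (\sum_(i < n | `[< [set` Pitv j] `<=` [set` fn_dom F i] >]) fn_sign F i).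

Lemma e_ser_unit j : e_ser j \is a GRing.unit.
Proof. exact: fps_one_subX_unit. Qed.

(* The value does not depend on j. *)
Definition kneading_det (j : 'I_k.+1) : fps rat :=
  (-1) ^+ j / e_ser j * \det (col' j kneading_matrix : 'M[fps rat]_k).

End Kneading.

(* R[i] itself carries no topology; as a numFieldType it has the norm topology. *)
Definition cplx (R : realType) : numFieldType := R[i].

Section Complex.
Variable R : realType.
Local Notation C := (cplx R).

Definition modulus (z : C) : R := ComplexField.Normc.normc z.

Definition of_real (x : R) : C := (x%:C)%C.

(* the disc |z| < r, for r possibly infinite *)
Definition disc (r : \bar R) : set C := [set z | ((modulus z)%:E < r)%E].

Definition cpseries (a : nat -> C) (z : C) : C ^nat :=
  [series a m * z ^+ m]_m.

Definition holomorphic_at (f : C -> C) (z : C) : Prop :=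
  \forall w \near z, derivable f w 1.

Definition pole (f : C -> C) (z : C) : Prop :=
  (\forall w \near z^', derivable f w 1) /\
  modulus (f w) @[w --> z^'] --> +oo.

(* the value of f at a pole is irrelevant *)
Definition meromorphic_on (U : set C) (f : C -> C) : Prop :=
  forall z, U z -> holomorphic_at f z \/ pole f z.

End Complex.

(* Main.v *)
Require Import Defs.
From HB Require Import structures.
From mathcomp Require Import all_boot all_order all_algebra.
From mathcomp Require Import all_classical all_reals all_analysis.
From mathcomp Require Import complex.
From mathcomp Require Import ring lra.

Set Implicit Arguments.
Unset Strict Implicit.
Unset Printing Implicit Defensive.

Import Order.TTheory GRing.Theory Num.Theory.
Import numFieldNormedType.Exports.

Local Open Scope classical_set_scope.
Local Open Scope ring_scope.

(** Proof idea. One works with germs x- and x+ of the line rather than points. A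
    family of locally constant functions phi_m of a germ whose jump at a
    non-turning point x is the sum of the jumps of phi_(m-1) at the points f_r(x)
    is determined by its jumps at the turning points: phi = A * (jumps), where
    A_i(p) counts, by word length, the points below p which reach c_i as their
    first turning point. This is applied twice.
    - To the invariant coordinate: theta(p) = P_0 + A(p) N with N the kneading
      matrix. Combined with theta(p) = P_j + t sum_r sigma_r theta(f_r p) it gives
      a matrix U, whose entries have coefficients O(l(m)), with U N = [-e | I].
      Hence det U * D = 1 for the determinant D formed with any column deleted,
      and D has no zero in |t| < 1/s.
    - To the number of endpoints of domains lying below p: this gives
      2 t L(t) = sum_i A_i(+oo) L'_i(t), where L'_i is the series of l'_(c_i).
      Since A(+oo) is the last row of U, D * A(+oo) consists of minors of N. As
      |N_ij(m)| <= l'_(c_i)(m) + l'_(c_i)(m+1), both D and H = D * L converge for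
      |t| < 1/s_0, and L = H/D there.
    Finally l is submultiplicative, so l(m) >= s^m and L is unbounded on [0, 1/s):
    thus D vanishes at 1/s and H/D has a pole there. *)

(** * Power series over the complex numbers *)

(** Germs are used because points are ambiguous exactly where it matters: at a turning point the
    symbol D(x) is an average, and a domain may or may not contain its ends. Points close to a germ
    avoid all turning points under any given word, so both ambiguities vanish. The obstacle is that
    U, the inverse of N, is only known to converge for |t| < 1/s. Whatever has to be continued
    beyond must be rewritten through minors of N and the series L'_i, which converge for |t| <
    1/s_0. The analysis rests on two devices. Dividing a convergent series by X - z keeps its disc
    of convergence; this yields the value of a product, continuity, derivatives and the cancellation
    of common zeros. That each zero of D has finite order, so that H/D is meromorphic, comes from a
    bound of Jensen type: if (X - z)^p divides a series a whose squared Hardy norm on the circle of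
    radius rho > |z| is at most B, then |a_0|^2 <= B (|z|/rho)^(2p). For large p this contradicts
    D(0) != 0, which holds because D is invertible. *)

Section ComplexTopology.
Variable R : realType.
Local Notation C := (cplx R).
Implicit Types (z w : C) (x : R).

Lemma normE z : `|z| = of_real (modulus z).
Proof. by case: z => a b; rewrite /modulus /=. Qed.

Lemma modulus_ge0 z : 0 <= modulus z.
Proof. by case: z => a b; rewrite /modulus /= sqrtr_ge0. Qed.

Lemma modulusM z w : modulus (z * w) = modulus z * modulus w.
Proof. exact: ComplexField.Normc.normcM. Qed.

Lemma modulus0 : modulus (0 : C) = 0.
Proof. exact: ComplexField.Normc.normc0. Qed.

Lemma modulus1 : modulus (1 : C) = 1.
Proof. exact: ComplexField.Normc.normc1. Qed.

Lemma modulusN z : modulus (- z) = modulus z.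
Proof. by case: z => a b; rewrite /modulus /= !sqrrN. Qed.

Lemma modulusB z w : modulus (z - w) = modulus (w - z).
Proof. by rewrite -modulusN opprB. Qed.

Lemma modulusV z : modulus z^-1 = (modulus z)^-1.
Proof. exact: ComplexField.Normc.normcV. Qed.

Lemma modulusX z m : modulus (z ^+ m) = modulus z ^+ m.
Proof. by elim: m => [|m IH]; rewrite ?modulus1// !exprS modulusM IH. Qed.

Lemma le_of_real x1 x2 : (of_real x1 <= of_real x2) = (x1 <= x2).
Proof. by rewrite /of_real lecE /= eqxx. Qed.

Lemma lt_of_real x1 x2 : (of_real x1 < of_real x2) = (x1 < x2).
Proof. by rewrite /of_real ltcE /= eqxx. Qed.

Lemma modulusD z w : modulus (z + w) <= modulus z + modulus w.
Proof.
have := ler_normD z w; rewrite !normE.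
have -> : of_real (modulus z) + of_real (modulus w)
  = of_real (modulus z + modulus w) by rewrite /of_real rmorphD.
by rewrite le_of_real.
Qed.

Lemma modulus_leB z w : modulus z <= modulus w + modulus (w - z).
Proof. by have := modulusD w (z - w); rewrite subrKC -modulusB. Qed.

Lemma modulus_eq0 z : (modulus z == 0) = (z == 0).
Proof.
apply/eqP/eqP => [|->]; last exact: modulus0.
exact: ComplexField.Normc.eq0_normc.
Qed.

Lemma modulus_gt0 z : (0 < modulus z) = (z != 0).
Proof. by rewrite lt_neqAle modulus_ge0 andbT eq_sym modulus_eq0. Qed.

Lemma modulus_of_real x : modulus (of_real x) = `|x|.
Proof. by rewrite /modulus /= expr0n /= addr0 sqrtr_sqr. Qed.

Lemma modulus_sum (I : Type) (r : seq I) (P : pred I) (f : I -> C) :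
  modulus (\sum_(i <- r | P i) f i) <= \sum_(i <- r | P i) modulus (f i).
Proof.
elim/big_ind2 : _ => //; first by rewrite modulus0.
by move=> x1 x2 y1 y2 h1 h2; rewrite (le_trans (modulusD _ _)) // lerD.
Qed.

(** The norm on [cplx R] is complex-valued, so the radii of its balls are complex numbers. A
    positive complex number is real, which lets [cvg_modulusP] and [near_modulusP] work with real
    radii. *)
Lemma cvg_modulusP (T : Type) (F : set_system T) {FF : Filter F} (f : T -> C) z :
  f @ F --> z <->
  forall e : R, 0 < e -> \forall x \near F, modulus (f x - z) < e.
Proof.
rewrite cvgrPdist_lt; split=> h e e0.
  have := h (of_real e); rewrite -(lt_of_real 0 e) in e0.
  move/(_ e0); apply: filterS => x.
  by rewrite normE lt_of_real modulusB.
move: e0; rewrite ltcE /= => /andP[/eqP im0 re0].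
have -> : e = of_real (complex.Re e) by case: e im0 {re0} => a b /= ->.
apply: filterS (h _ re0) => x.
by rewrite normE lt_of_real modulusB.
Qed.

Lemma near_modulusP z (P : set C) :
  (\forall w \near z, P w) <->
  exists2 e : R, 0 < e & forall w, modulus (w - z) < e -> P w.
Proof.
split=> [[e /= e0 h]|[e e0 h]].
  move: e0 h; rewrite ltcE /= => /andP[/eqP im0 re0] h.
  have eE : e = of_real (complex.Re e) by case: e im0 {re0 h} => a b /= ->.
  exists (complex.Re e) => // w wz; apply: h => /=.
  by rewrite eE normE modulusB lt_of_real.
exists (of_real e) => /=; first by rewrite -[0]/(of_real 0) lt_of_real.
by move=> w /=; rewrite normE lt_of_real modulusB; exact: h.
Qed.

Lemma cvg_modulus_seq (u : nat -> C) z (v : nat -> R) :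
  v @ \oo --> (0 : R) -> (forall m, modulus (u m - z) <= v m) -> u @ \oo --> z.
Proof.
move=> v0 uv; apply/cvg_modulusP => e e0.
have /cvgrPdist_lt/(_ _ e0) := v0; apply: filterS => m.
rewrite sub0r normrN; apply: le_lt_trans.
by rewrite (le_trans (uv m)) ?ler_norm.
Qed.

Lemma modulus_Re z : `|complex.Re z| <= modulus z.
Proof.
case: z => a b; rewrite /modulus /= -sqrtr_sqr ler_wsqrtr //.
by rewrite lerDl sqr_ge0.
Qed.

Lemma modulus_Im z : `|complex.Im z| <= modulus z.
Proof.
case: z => a b; rewrite /modulus /= -sqrtr_sqr ler_wsqrtr //.
by rewrite lerDr sqr_ge0.
Qed.

Lemma modulus_le_ReIm z : modulus z <= `|complex.Re z| + `|complex.Im z|.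
Proof.
rewrite -(ger0_norm (addr_ge0 (normr_ge0 (complex.Re z)) (normr_ge0 (complex.Im z)))).
rewrite -sqrtr_sqr; case: z => a b; rewrite /modulus /= ler_wsqrtr //.
rewrite sqrrD !real_normK ?num_real // lerD2r lerDl mulrn_wge0 // mulr_ge0.
Qed.

(** Completeness comes from the reals: real and imaginary parts are dominated by the modulus, hence
    converge absolutely. *)
Lemma cplx_normed_cvg (u : nat -> C) :
  cvgn [series modulus (u m)]_m -> cvgn (series u : nat -> C).
Proof.
move=> cu.
have cRe : cvgn (series (fun m => complex.Re (u m))).
  apply: normed_cvg; apply: series_le_cvg cu => m //=.
  - exact: modulus_ge0.
  - exact: modulus_Re.
have cIm : cvgn (series (fun m => complex.Im (u m))).
  apply: normed_cvg; apply: series_le_cvg cu => m //=.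
  - exact: modulus_ge0.
  - exact: modulus_Im.
pose a := limn (series (fun m => complex.Re (u m))).
pose b := limn (series (fun m => complex.Im (u m))).
have ReE m : complex.Re (series u m) = series (fun m => complex.Re (u m)) m.
  rewrite /series /=; apply: (big_morph (fun z : C => complex.Re z)) => //.
  by case=> [? ?] [? ?].
have ImE m : complex.Im (series u m) = series (fun m => complex.Im (u m)) m.
  rewrite /series /=; apply: (big_morph (fun z : C => complex.Im z)) => //.
  by case=> [? ?] [? ?].
apply/cvg_ex; exists (Complex a b : C); apply/cvg_modulusP => e e0.
have e20 : 0 < e / 2 by rewrite divr_gt0.
have /cvgrPdist_lt/(_ _ e20) h1 := cRe.
have /cvgrPdist_lt/(_ _ e20) h2 := cIm.
near=> m; rewrite modulusB (le_lt_trans (modulus_le_ReIm _)) //.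
rewrite (splitr e) ltrD //.
- suff -> : complex.Re (Complex a b - series u m) = a - series (fun m => complex.Re (u m)) m.
    by near: m; exact: h1.
  by rewrite -ReE; case: (series u m).
- suff -> : complex.Im (Complex a b - series u m) = b - series (fun m => complex.Im (u m)) m.
    by near: m; exact: h2.
  by rewrite -ImE; case: (series u m).
Unshelve. all: by end_near. Qed.

Lemma modulus_limn_le (u : nat -> C) z (K : R) :
  u @ \oo --> z -> (forall m, modulus (u m) <= K) -> modulus z <= K.
Proof.
move=> uz uK; apply/ler_addgt0Pr => e e0.
have /cvg_modulusP/(_ _ e0) [N _ /(_ N)] := uz; move=> /(_ (leqnn N)) h.
rewrite -(subrK (u N) z) (le_trans (modulusD _ _)) // addrC lerD //.
by rewrite modulusB ltW.
Qed.

End ComplexTopology.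

Section FpsCoefs.
Variable K : comNzRingType.
Implicit Types a b : fps K.

Lemma coefsD a b m : coefs (a + b) m = coefs a m + coefs b m.
Proof. by []. Qed.

Lemma coefsN a m : coefs (- a) m = - coefs a m.
Proof. by []. Qed.

Lemma coefs_sum (I : Type) (r : seq I) (P : pred I) (f : I -> fps K) m :
  coefs (\sum_(i <- r | P i) f i) m = \sum_(i <- r | P i) coefs (f i) m.
Proof.
by apply: (big_morph (fun a => coefs a m)) => //=; rewrite mul0rn.
Qed.

Lemma coefsC x m : coefs (fpsC x : fps K) m = x *+ (m == 0%N).
Proof. by []. Qed.

Lemma fpsC0 : fpsC 0 = 0 :> fps K.
Proof. by []. Qed.

Definition fps_shift a := Fps (fun m => coefs a m.+1).

Lemma coefs_iter_shift k a m :
  coefs (iter k fps_shift a) m = coefs a (k + m)%N.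
Proof. by elim: k m => [|k IH] m //=; rewrite IH addnS. Qed.

Lemma fps_shiftE a : a = fpsC (coefs a 0%N) + fpsX K * fps_shift a.
Proof.
apply: fpsP => m; rewrite coefsD coefs_mulX coefsC.
by case: m => [|m]; rewrite ?mulr1n ?mulr0n ?addr0 ?add0r.
Qed.

Lemma fps_shiftMX a : fps_shift (fpsX K * a) = a.
Proof.
by apply: fpsP => m; rewrite -[LHS]/(coefs (fpsX K * a) m.+1) coefs_mulX.
Qed.

End FpsCoefs.

(** * Evaluation of power series in a disc *)

Section PowerSeries.
Variables (R : realType) (sg : R).
Local Notation C := (cplx R).
Hypothesis sg_ge0 : 0 <= sg.
Implicit Types (a b g : fps C) (z w : C).

(** Convergence for |z| < 1/sg, written as a growth bound on the coefficients so that sg = 0, an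
    infinite radius, needs no separate treatment; [indisc] avoids the division for the same
    reason. *)
Definition sconv a := forall r, sg < r ->
  exists M : R, forall m, modulus (coefs a m) <= M * r ^+ m.

Definition ceval a z : C := limn (cpseries (coefs a) z).

Definition indisc z := modulus z * sg < 1.

Lemma indisc_radius z : indisc z -> exists2 r, sg < r & modulus z * r < 1.
Proof.
move=> zsg; have [z0|z_neq0] := eqVneq (modulus z) 0.
  by exists (sg + 1); rewrite ?ltrDl // z0 mul0r.
have z0 : 0 < modulus z by rewrite lt_neqAle eq_sym z_neq0 modulus_ge0.
have : sg < (modulus z)^-1 by rewrite -(ltr_pM2l z0) divff.
move=> /midf_lt[h1 h2]; exists ((sg + (modulus z)^-1) / 2%:R) => //.
by rewrite -(ltr_pM2l z0) divff // in h2.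
Qed.

Lemma bounded_cpseries_cvg a z (M r : R) :
  0 <= r -> modulus z * r < 1 ->
  (forall m, modulus (coefs a m) <= M * r ^+ m) ->
  cvgn (cpseries (coefs a) z) /\ modulus (ceval a z) <= M / (1 - modulus z * r).
Proof.
move=> r0 zr aM; set q := modulus z * r.
have q0 : 0 <= q by rewrite mulr_ge0 ?modulus_ge0.
have le_geo m : modulus (coefs a m * z ^+ m) <= geometric M q m.
  rewrite modulusM modulusX /geometric /= /q exprMn [leRHS]mulrCA.
  by rewrite [leLHS]mulrC ler_wpM2l ?exprn_ge0 ?modulus_ge0.
have M0 : 0 <= M by have := aM 0%N; rewrite expr0 mulr1; apply/le_trans/modulus_ge0.
have q1 : `|q| < 1 by rewrite ger0_norm.
have cz : cvgn (cpseries (coefs a) z).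
  apply: cplx_normed_cvg; apply: series_le_cvg (@is_cvg_geometric_series _ M q q1) => m.
  - exact: modulus_ge0.
  - by rewrite /geometric /= mulr_ge0 ?exprn_ge0.
  - exact: le_geo.
split=> //; apply: (modulus_limn_le cz) => m.
rewrite /cpseries /series /= (le_trans (modulus_sum _ _ _)) //.
apply: le_trans (_ : \sum_(0 <= i < m) geometric M q i <= _).
  by apply: ler_sum => i _; exact: le_geo.
have -> : \sum_(0 <= i < m) geometric M q i = M * (1 - q ^+ m) / (1 - q).
  have := @geometric_seriesE _ M q; rewrite lt_eqF // => /(_ isT) E.
  by have := congr1 (fun f => f m) E.
rewrite ler_pM2r ?invr_gt0 ?subr_gt0 // ler_piMr //.
by rewrite lerBlDr lerDl exprn_ge0.
Qed.

Lemma ceval_cvg a z : sconv a -> indisc z ->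
  cpseries (coefs a) z @ \oo --> ceval a z.
Proof.
move=> ca /indisc_radius[r sgr zr]; have [M aM] := ca _ sgr.
by have [] := bounded_cpseries_cvg (le_trans sg_ge0 (ltW sgr)) zr aM.
Qed.

Lemma cevalP a z l : cpseries (coefs a) z @ \oo --> l -> ceval a z = l.
Proof. by move=> h; apply: cvg_lim h; exact: norm_hausdorff. Qed.

Lemma sconvD a b : sconv a -> sconv b -> sconv (a + b).
Proof.
move=> ca cb r sgr; have [M1 h1] := ca _ sgr; have [M2 h2] := cb _ sgr.
exists (M1 + M2) => m; rewrite coefsD mulrDl (le_trans (modulusD _ _)) //.
exact: lerD.
Qed.

Lemma sconvN a : sconv a -> sconv (- a).
Proof.
move=> ca r sgr; have [M h] := ca _ sgr.
by exists M => m; rewrite coefsN modulusN.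
Qed.

Lemma sconvC (x : C) : sconv (fpsC x).
Proof.
move=> r sgr; exists (modulus x) => -[|m].
  by rewrite coefsC mulr1n expr0 mulr1.
rewrite coefsC mulr0n modulus0 mulr_ge0 ?modulus_ge0 // exprn_ge0 //.
by rewrite (le_trans sg_ge0) ?ltW.
Qed.

Lemma sconv1 : sconv 1. Proof. exact: sconvC. Qed.

Lemma sconvMX a : sconv a -> sconv (fpsX C * a).
Proof.
move=> ca r sgr; have [M h] := ca _ sgr.
have r0 : 0 < r by rewrite (le_lt_trans sg_ge0).
exists (M / r) => -[|m]; rewrite coefs_mulX.
  rewrite modulus0 expr0 mulr1 divr_ge0 ?(ltW r0) //.
  by have := h 0%N; rewrite expr0 mulr1; apply/le_trans/modulus_ge0.
by rewrite exprS mulrA divfK ?gt_eqF.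
Qed.

Lemma sconvX : sconv (fpsX C).
Proof. by rewrite -[fpsX C]mulr1; exact/sconvMX/sconv1. Qed.

(* The polynomial factor [m + 1] coming from the Cauchy product is absorbed by
   comparing at a radius strictly between [sg] and [r]. *)
Lemma sconvM a b : sconv a -> sconv b -> sconv (a * b).
Proof.
move=> ca cb r sgr; have [sg1 r1r] := midf_lt sgr.
set r1 := (sg + r) / 2%:R in sg1 r1r.
have [M1 h1] := ca _ sg1; have [M2 h2] := cb _ sg1.
have r1_gt0 : 0 < r1 by rewrite (le_lt_trans sg_ge0).
have r_gt0 : 0 < r by rewrite (lt_trans r1_gt0).
have M1_ge0 : 0 <= M1.
  by have := h1 0%N; rewrite expr0 mulr1; apply/le_trans/modulus_ge0.
have M2_ge0 : 0 <= M2.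
  by have := h2 0%N; rewrite expr0 mulr1; apply/le_trans/modulus_ge0.
have d_gt0 : 0 < r / r1 - 1 by rewrite subr_gt0 ltr_pdivlMr // mul1r.
(* With q = r / r1, Bernoulli gives 1 + m (q - 1) <= q^m; since K >= 1 and K (q - 1) >= 1,
   multiplying by K bounds m + 1. *)
pose K := Num.max 1 (r / r1 - 1)^-1.
have bern m : m.+1%:R * r1 ^+ m <= K * r ^+ m.
  have K_gt0 : 0 < K by rewrite lt_max ltr01.
  suff h : m.+1%:R <= K * (r / r1) ^+ m.
    rewrite -[leRHS](_ : K * (r / r1) ^+ m * r1 ^+ m = _); last first.
      by rewrite -mulrA -exprMn divfK // gt_eqF.
    by rewrite ler_wpM2r // exprn_ge0 // ltW.
  have hb : 1 + m%:R * (r / r1 - 1) <= (r / r1) ^+ m.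
    elim: m => [|m IH]; first by rewrite mul0r addr0 expr0.
    have := ler_wpM2l (ltW (divr_gt0 r_gt0 r1_gt0)) IH; rewrite -exprS.
    apply: le_trans; rewrite -subr_ge0.
    set q := r / r1; have -> : q * (1 + m%:R * (q - 1)) - (1 + m.+1%:R * (q - 1))
      = m%:R * (q - 1) ^+ 2 by rewrite -natr1; ring.
    by rewrite mulr_ge0 // sqr_ge0.
  apply: le_trans (ler_wpM2l (ltW K_gt0) hb).
  rewrite mulrDr mulr1 -natr1 addrC lerD // ?le_max ?lexx //.
  by rewrite mulrCA ler_peMr // -ler_pdivrMr // mul1r le_max lexx orbT.
exists (K * (M1 * M2)) => m; rewrite coefs_mul (le_trans (modulus_sum _ _ _)) //.
apply: (@le_trans _ _ (\sum_(i < m.+1) (M1 * M2) * r1 ^+ m)).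
  apply: ler_sum => i _; rewrite modulusM.
  apply: le_trans (ler_pM (modulus_ge0 _) (modulus_ge0 _) (h1 _) (h2 _)) _.
  by rewrite mulrACA -exprD subnKC // -ltnS.
rewrite sumr_const card_ord -mulr_natl mulrCA [K * _]mulrC -[leRHS]mulrA.
by rewrite ler_wpM2l ?mulr_ge0 // bern.
Qed.

Lemma sconv_shift a : sconv a -> sconv (fps_shift a).
Proof.
move=> ca r sgr; have [M h] := ca _ sgr.
by exists (M * r) => m; rewrite /= -mulrA -exprS.
Qed.

Lemma cevalD a b z : sconv a -> sconv b -> indisc z ->
  ceval (a + b) z = ceval a z + ceval b z.
Proof.
move=> ca cb dz; apply: cevalP.
have -> : cpseries (coefs (a + b)) z
    = cpseries (coefs a) z \+ cpseries (coefs b) z.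
  apply/funext => m; rewrite /cpseries /series /= -big_split /=.
  by apply: eq_bigr => i _; rewrite mulrDl.
by apply: cvgD; exact: ceval_cvg.
Qed.

Lemma cevalZ x a z : sconv a -> indisc z -> ceval (fpsC x * a) z = x * ceval a z.
Proof.
move=> ca dz; apply: cevalP.
have -> : cpseries (coefs (fpsC x * a)) z = (fun m => x * cpseries (coefs a) z m).
  apply/funext => m; rewrite /cpseries /series /= big_distrr /=.
  apply: eq_bigr => i _.
  by rewrite -[X in X * _ = _]/(coefs (fpsC x * a) i) coefs_mulC mulrA.
by apply: cvgMl_tmp; exact: ceval_cvg.
Qed.

Lemma cevalC x z : ceval (fpsC x) z = x.
Proof.
apply: cevalP; apply: (@cvg_modulus_seq _ _ _ (fun m => modulus x *+ (m == 0%N))).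
  apply: cvg_near_cst; exists 1%N => // m /=; case: m => // m _; exact: mulr0n.
case=> [|m]; first by rewrite /cpseries /series /= big_nil sub0r modulusN.
rewrite /cpseries /series /= big_nat_recl //= big1 => [|i _].
  by rewrite mulr1n expr0 mulr1 addr0 subrr modulus0.
by rewrite mulr0n mul0r.
Qed.

Lemma cevalMX a z : sconv a -> indisc z -> ceval (fpsX C * a) z = z * ceval a z.
Proof.
move=> ca dz; apply: cevalP; rewrite -(cvg_shiftS _).
have -> : (fun m => cpseries (coefs (fpsX C * a)) z m.+1)
   = (fun m => z * cpseries (coefs a) z m).
  apply/funext => m; rewrite /cpseries /series /= big_nat_recl //=.
  rewrite -[X in X * _ + _]/(coefs (fpsX C * a) 0%N) coefs_mulX mul0r add0r.
  rewrite big_distrr /=; apply: eq_bigr => i _.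
  rewrite -[X in X * _ = _]/(coefs (fpsX C * a) i.+1) coefs_mulX exprS.
  by rewrite mulrCA.
by apply: cvgMl_tmp; exact: ceval_cvg.
Qed.

Lemma ceval_shift a z : sconv a -> indisc z ->
  ceval a z = coefs a 0%N + z * ceval (fps_shift a) z.
Proof.
move=> ca dz; rewrite {1}(fps_shiftE a) cevalD //.
- by rewrite cevalC cevalMX //; exact: sconv_shift.
- exact: sconvC.
- exact/sconvMX/sconv_shift.
Qed.

(** Horner's scheme: the quotient of a - a(z) by X - z, whose coefficient of index m is the sum of
    a_(m+1+i) z^i over i. *)
Definition fps_div a z := Fps (fun m => ceval (iter m.+1 (@fps_shift C) a) z).

Lemma sconv_iter_shift k a : sconv a -> sconv (iter k (@fps_shift C) a).
Proof. by move=> ca; elim: k => //= k; exact: sconv_shift. Qed.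

Lemma fps_divE a z : sconv a -> indisc z ->
  a = fpsC (ceval a z) + (fpsX C - fpsC z) * fps_div a z.
Proof.
move=> ca dz; apply: fpsP => m.
rewrite mulrBl !coefsD coefsN coefs_mulX coefs_mulC coefsC.
case: m => [|m] /=.
  by rewrite mulr1n sub0r (ceval_shift ca dz) addrK.
rewrite mulr0n add0r.
rewrite [X in _ = X - _](ceval_shift (sconv_iter_shift m.+1 ca) dz).
by rewrite -iterS coefs_iter_shift addn0 addrK.
Qed.

Lemma sconv_div a z : sconv a -> indisc z -> sconv (fps_div a z).
Proof.
move=> ca /indisc_radius[r0 sgr0 zr0] r sgr.
(* The radius must be at most r0 for the tails to converge at z, and at most r for the bound
   sought. *)
pose r1 := Num.min r0 r.
have sgr1 : sg < r1 by rewrite lt_min sgr0.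
have r1_ge0 : 0 <= r1 by rewrite (le_trans sg_ge0) ?ltW.
have zr1 : modulus z * r1 < 1.
  by rewrite (le_lt_trans _ zr0) // ler_wpM2l ?modulus_ge0 // ge_min lexx.
have [M aM] := ca _ sgr1.
have M0 : 0 <= M.
  by have := aM 0%N; rewrite expr0 mulr1; apply/le_trans/modulus_ge0.
exists (M * r1 / (1 - modulus z * r1)) => m /=.
have [i|_ ] := @bounded_cpseries_cvg (iter m.+1 (@fps_shift C) a) z (M * r1 ^+ m.+1) r1
  r1_ge0 zr1; first by rewrite coefs_iter_shift -mulrA -exprD.
move=> /le_trans; apply; rewrite exprS mulrA mulrAC ler_wpM2l //.
  by rewrite divr_ge0 ?mulr_ge0 // subr_ge0 ltW.
have r1r : r1 <= r by rewrite ge_min lexx orbT.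
by rewrite lerXn2r ?nnegrE // (le_trans r1_ge0).
Qed.

Lemma cevalXB a z : sconv a -> indisc z ->
  ceval ((fpsX C - fpsC z) * a) z = 0.
Proof.
move=> ca dz; rewrite mulrBl cevalD ?cevalMX //.
- rewrite -mulNr (_ : - fpsC z = fpsC (- z)) ?cevalZ ?mulNr ?subrr //.
  by apply: fpsP => m; rewrite coefsN !coefsC mulNrn.
- exact: sconvMX.
- by apply/sconvN/sconvM => //; exact: sconvC.
Qed.

Lemma sconvXB z : sconv (fpsX C - fpsC z).
Proof. by apply: sconvD; [exact: sconvX|exact/sconvN/sconvC]. Qed.

(* Divide the first factor by [X - z]: the Cauchy product needs no
   rearrangement of double series. *)
Lemma cevalM a b z : sconv a -> sconv b -> indisc z ->
  ceval (a * b) z = ceval a z * ceval b z.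
Proof.
move=> ca cb dz; rewrite {1}(fps_divE ca dz) mulrDl -mulrA.
have cd := sconvM (sconv_div ca dz) cb.
rewrite cevalD ?cevalZ ?cevalXB ?addr0 //.
  by apply: sconvM => //; exact: sconvC.
by apply: sconvM => //; exact: sconvXB.
Qed.

Lemma ceval_XBM a z w : sconv a -> indisc w ->
  ceval ((fpsX C - fpsC z) * a) w = (w - z) * ceval a w.
Proof.
move=> ca dw; rewrite cevalM //; last exact: sconvXB.
congr (_ * _); rewrite cevalD //; [|exact: sconvX|exact/sconvN/sconvC].
rewrite (_ : - fpsC z = fpsC (- z)) ?cevalC; last first.
  by apply: fpsP => m; rewrite coefsN !coefsC mulNrn.
rewrite -[fpsX C]mulr1 cevalMX //; last exact: sconv1.
by rewrite (cevalC 1) mulr1.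
Qed.

Lemma indisc_near z : indisc z -> \forall w \near z, indisc w.
Proof.
move=> dz; apply/near_modulusP; rewrite /indisc in dz *.
have s1 : 0 < sg + 1 by rewrite ltr_wpDl.
exists ((1 - modulus z * sg) / (sg + 1)); first by rewrite divr_gt0 ?subr_gt0.
move=> w; rewrite ltr_pdivlMr // => wz.
have h : modulus w <= modulus (w - z) + modulus z.
  by rewrite -{1}(subrK z w) modulusD.
have h1 := modulus_ge0 (w - z).
have := ler_wpM2r sg_ge0 h; rewrite /indisc; nra.
Qed.

(** One has a(w) - a(z) = (w - z) q(w) with q = [fps_div a z], and q is bounded near z. *)
Lemma ceval_continuous a z : sconv a -> indisc z ->
  ceval a w @[w --> z] --> ceval a z.
Proof.
move=> ca dz; apply/(@cvg_modulusP _ _ (nbhs z)) => e e0.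
have cd := sconv_div ca dz.
have [r sgr zr] := indisc_radius dz; have [M dM] := cd _ sgr.
have r_ge0 : 0 <= r by rewrite (le_trans sg_ge0) ?ltW.
have M0 : 0 <= M.
  by have := dM 0%N; rewrite expr0 mulr1; apply/le_trans/modulus_ge0.
(* Half of the gap between |z| r and 1: near z one has |w| r <= 1 - d, so q is bounded there by M /
   d. *)
pose d := (1 - modulus z * r) / 2.
have d0 : 0 < d by rewrite divr_gt0 // subr_gt0.
have r1 : 0 < r + 1 by rewrite ltr_wpDl.
have Md1 : 0 < M / d + 1 by rewrite ltr_wpDl // divr_ge0 // ltW.
near=> w.
have dw : indisc w by near: w; exact: indisc_near.
have wzd : modulus (w - z) * r < d.
  near: w; apply/near_modulusP; exists (d / (r + 1)); first by rewrite divr_gt0.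
  move=> w; rewrite ltr_pdivlMr // mulrDr mulr1.
  by apply: le_lt_trans; rewrite lerDl modulus_ge0.
have wze : modulus (w - z) * (M / d) < e.
  near: w; apply/near_modulusP; exists (e / (M / d + 1)); first by rewrite divr_gt0.
  move=> w; rewrite ltr_pdivlMr // mulrDr mulr1.
  by apply: le_lt_trans; rewrite lerDl modulus_ge0.
have wr : modulus w * r <= 1 - d.
  have h : modulus w <= modulus (w - z) + modulus z.
    by rewrite -{1}(subrK z w) modulusD.
  have := ler_wpM2r r_ge0 h; rewrite mulrDl => /le_trans; apply.
  have : modulus z * r = 1 - d - d by rewrite /d; field.
  by move=> ->; rewrite addrC -lerBrDr lerB // ?lerB // ltW.
rewrite {1}(fps_divE ca dz) cevalD //; last 2 first.
- exact: sconvC.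
- by apply: sconvM => //; exact: sconvXB.
rewrite cevalC ceval_XBM // addrC addKr modulusM.
apply: le_lt_trans wze; rewrite ler_wpM2l ?modulus_ge0 //.
have wr1 : modulus w * r < 1 by rewrite (le_lt_trans wr) // ltrBlDr ltrDl.
have [_ /le_trans->//] := bounded_cpseries_cvg r_ge0 wr1 dM.
rewrite ler_wpM2l // lef_pV2 ?posrE ?subr_gt0 //.
by rewrite lerBrDr addrC -lerBrDr.
Unshelve. all: by end_near. Qed.

Lemma ceval_near_neq0 a z : sconv a -> indisc z -> ceval a z != 0 ->
  \forall w \near z, ceval a w != 0.
Proof.
move=> ca dz az; have /(@cvg_modulusP _ _ (nbhs z))/(_ (modulus (ceval a z))) := ceval_continuous ca dz.
rewrite modulus_gt0 => /(_ az); apply: filterS => w.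
apply: contraTneq => ->; by rewrite sub0r modulusN ltxx.
Qed.

(** The difference quotient at z is exactly the value of [fps_div a z] at the displaced point, so
    the continuity of that series gives the derivative. *)
Lemma ceval_derivable a z : sconv a -> indisc z -> derivable (ceval a) z 1.
Proof.
move=> ca dz; have cd := sconv_div ca dz.
apply/cvg_ex; exists (ceval (fps_div a z) z); apply/cvg_modulusP => e e0.
have /(@cvg_modulusP _ _ (nbhs z))/(_ _ e0)/near_modulusP[d1 d10 h1] := ceval_continuous cd dz.
have /near_modulusP[d2 d20 h2] := indisc_near dz.
rewrite near_withinE; apply/near_modulusP.
exists (Num.min d1 d2); first by rewrite lt_min d10.
move=> h; rewrite subr0 lt_min => /andP[hd1 hd2] h0.
have hz : h *: (1 : C) + z - z = h by rewrite addrK /GRing.scale /= mulr1.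
rewrite (_ : _ *: _ = ceval (fps_div a z) (h *: 1 + z)); first by rewrite h1 ?hz.
rewrite /= {1}(fps_divE ca dz) cevalD; last 3 first.
- exact: sconvC.
- by apply: sconvM => //; exact: sconvXB.
- by rewrite h2 ?hz.
rewrite cevalC ceval_XBM ?h2 ?hz // addrC addKr.
by rewrite /GRing.scale /= mulKf.
Qed.

End PowerSeries.

(** * Zeros of a convergent series have finite order *)

Section ZeroOrder.
Variables (R : realType) (sg : R).
Local Notation C := (cplx R).
Hypothesis sg_ge0 : 0 <= sg.
Implicit Types (a b g : fps C) (z w : C).

Lemma sqr_modulus z : modulus z ^+ 2 = complex.Re z ^+ 2 + complex.Im z ^+ 2.
Proof. by case: z => a b; rewrite sqr_sqrtr // addr_ge0 ?sqr_ge0. Qed.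

Definition prev_coef a m : C := if m is m'.+1 then coefs a m' else 0.

(* Multiplying [X - z] by the Blaschke factor (rho^2 - z^* X) / (rho (X - z))
   preserves the Hardy norm on the circle of radius rho; on coefficients this is
   a telescoping identity. *)
Lemma blaschke_identity (rho : R) z (x y : C) :
  modulus ((rho ^+ 2)%:C%C * x - z^*%C * y) ^+ 2 -
  rho ^+ 2 * modulus (y - z * x) ^+ 2 =
  (rho ^+ 2 - modulus z ^+ 2) * (rho ^+ 2 * modulus x ^+ 2 - modulus y ^+ 2).
Proof. by rewrite !sqr_modulus; case: z x y => [a b] [c d] [e f] /=; ring. Qed.

(** Partial sums of the squared Hardy norm: by Parseval their limit is the mean of |a|^2 over the
    circle of radius rho. *)
Definition hardy (rho : R) a N :=
  \sum_(m < N.+1) modulus (coefs a m) ^+ 2 * rho ^+ (2 * m).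

Lemma hardy0 (rho : R) a : hardy rho a 0 = modulus (coefs a 0%N) ^+ 2.
Proof. by rewrite /hardy big_ord1 muln0 expr0 mulr1. Qed.

Lemma hardyS (rho : R) a N : hardy rho a N.+1 =
  hardy rho a N + modulus (coefs a N.+1) ^+ 2 * rho ^+ (2 * N.+1).
Proof. by rewrite /hardy big_ord_recr. Qed.

(** Truncation spoils the isometry only by one term, that of index N, which tends to 0 by
    [hardy_cvg0]. *)
Lemma hardy_blaschke (rho : R) z g N :
  hardy rho ((fpsC (rho ^+ 2)%:C%C - fpsX C * fpsC z^*%C) * g) N =
  rho ^+ 2 * hardy rho ((fpsX C - fpsC z) * g) N +
  rho ^+ 2 * (rho ^+ 2 - modulus z ^+ 2) *
    (modulus (coefs g N) ^+ 2 * rho ^+ (2 * N)).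
Proof.
have hE m : coefs ((fpsC (rho ^+ 2)%:C%C - fpsX C * fpsC z^*%C) * g) m =
    (rho ^+ 2)%:C%C * coefs g m - z^*%C * prev_coef g m.
  rewrite mulrBl -mulrA coefsD coefsN coefs_mulX !coefs_mulC.
  by case: m => [|m]; rewrite /prev_coef ?mulr0 // coefs_mulC.
have fE m : coefs ((fpsX C - fpsC z) * g) m = prev_coef g m - z * coefs g m.
  by rewrite mulrBl coefsD coefsN coefs_mulX coefs_mulC; case: m.
elim: N => [|N IH].
  rewrite !hardy0 hE fE /prev_coef muln0 expr0 mulr1.
  have := blaschke_identity rho z (coefs g 0%N) 0; rewrite modulus0.
  by move/eqP; rewrite subr_eq => /eqP ->; ring.
rewrite !hardyS IH hE fE /prev_coef.
have := blaschke_identity rho z (coefs g N.+1) (coefs g N).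
move/eqP; rewrite subr_eq => /eqP ->.
by rewrite mulnS exprD; ring.
Qed.

Lemma hardy_mono rho a M N : 0 <= rho -> (M <= N)%N -> hardy rho a M <= hardy rho a N.
Proof.
move=> rho0 /subnK <-; elim: (N - M)%N => [|k IH]; first by rewrite add0n.
rewrite addSn (le_trans IH) // hardyS lerDl.
by rewrite mulr_ge0 ?sqr_ge0 // exprn_ge0.
Qed.

Lemma hardy_term_le (rho r M : R) a m : 0 < rho -> 0 <= r ->
  modulus (coefs a m) <= M * r ^+ m ->
  modulus (coefs a m) ^+ 2 * rho ^+ (2 * m) <= geometric (M ^+ 2) ((rho * r) ^+ 2) m.
Proof.
move=> rho0 r0 aM; rewrite /geometric /= mulnC !exprM [in leRHS]exprAC -!exprMn.
have rm : 0 <= rho ^+ m by rewrite exprn_ge0 // ltW.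
have le : modulus (coefs a m) * rho ^+ m <= M * (rho * r) ^+ m.
  by rewrite mulrC [in leRHS]exprMn mulrCA ler_wpM2l.
have ge0 : 0 <= modulus (coefs a m) * rho ^+ m by rewrite mulr_ge0 ?modulus_ge0.
by rewrite lerXn2r ?nnegrE // (le_trans ge0).
Qed.

Lemma hardy_cvg0 (rho r : R) a : sconv sg a -> sg < r -> 0 < rho -> rho * r < 1 ->
  (fun m => modulus (coefs a m) ^+ 2 * rho ^+ (2 * m)) @ \oo --> (0 : R).
Proof.
move=> ca sgr rho0 rhor; have [M aM] := ca _ sgr.
have r_ge0 : 0 <= r by rewrite (le_trans sg_ge0) ?ltW.
have q1 : `|(rho * r) ^+ 2| < 1.
  by rewrite ger0_norm ?sqr_ge0 // expr_lt1 // mulr_ge0 // ltW.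
apply: (@squeeze_cvgr _ _ _ _ (fun=> 0) (geometric (M ^+ 2) ((rho * r) ^+ 2))).
- apply: nearW => m; apply/andP; split.
    by rewrite mulr_ge0 ?sqr_ge0 // exprn_ge0 // ltW.
  exact: (hardy_term_le rho0 r_ge0 (aM m)).
- exact: cvg_cst.
- exact: cvg_geometric.
Qed.

Lemma hardy_bounded (rho r : R) a : sconv sg a -> sg < r -> 0 < rho -> rho * r < 1 ->
  exists B, forall N, hardy rho a N <= B.
Proof.
move=> ca sgr rho0 rhor; have [M aM] := ca _ sgr.
have r_ge0 : 0 <= r by rewrite (le_trans sg_ge0) ?ltW.
have q0 : 0 <= (rho * r) ^+ 2 by exact: sqr_ge0.
have q1 : (rho * r) ^+ 2 < 1 by rewrite expr_lt1 // mulr_ge0 // ltW.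
exists (M ^+ 2 / (1 - (rho * r) ^+ 2)) => N.
apply: (@le_trans _ _ (\sum_(0 <= m < N.+1) geometric (M ^+ 2) ((rho * r) ^+ 2) m)).
  rewrite /hardy big_mkord; apply: ler_sum => m _.
  exact: (hardy_term_le rho0 r_ge0 (aM m)).
have := @geometric_seriesE _ (M ^+ 2) ((rho * r) ^+ 2).
rewrite lt_eqF // => /(_ isT) E; have /= := congr1 (fun f => f N.+1) E.
rewrite /series /= => ->.
rewrite ler_pM2r ?invr_gt0 ?subr_gt0 // ler_piMr ?sqr_ge0 //.
by rewrite lerBlDr lerDl exprn_ge0.
Qed.

(** Each factor X - z is exchanged for rho^2 - z^* X. This multiplies the squared norm by rho^2 and,
    up to sign, replaces z by rho^2 in the constant term, which after p exchanges is still bounded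
    by the norm. The powers of |z| stay on the right so that z = 0 is allowed. *)
Lemma blaschke_bound (rho r : R) z p g B :
  sg < r -> 0 < rho -> rho * r < 1 -> modulus z <= rho -> sconv sg g ->
  (forall N, hardy rho ((fpsX C - fpsC z) ^+ p * g) N <= B) ->
  (rho ^+ 2) ^+ p * modulus (coefs ((fpsX C - fpsC z) ^+ p * g) 0%N) ^+ 2
    <= (modulus z ^+ 2) ^+ p * B.
Proof.
move=> sgr rho0 rhor zrho.
elim: p g B => [|p IH] g B cg hB.
  rewrite !expr0 !mul1r; have := hB 0%N.
  by rewrite hardy0 !mul1r.
set Y := fpsX C - fpsC z in hB *; set G := Y ^+ p * g.
set Z := fpsC (rho ^+ 2)%:C%C - fpsX C * fpsC z^*%C.
have cX : sconv sg (fpsX C) := sconvX sg_ge0.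
have cC x : sconv sg (fpsC x) := sconvC sg_ge0 x.
have cY : sconv sg Y by apply: sconvD; [exact: cX|exact/sconvN/cC].
have cZ : sconv sg Z by apply: sconvD; [exact: cC|exact/sconvN/sconvM].
have cYp : sconv sg (Y ^+ p).
  elim: (p) => [|k IHk]; first exact: sconv1.
  by rewrite exprS; exact: sconvM.
have cG : sconv sg G by exact: sconvM.
have YE : Y ^+ p.+1 * g = Y * G by rewrite exprS mulrA.
have ZE : Y ^+ p * (Z * g) = Z * G by rewrite mulrCA.
have cZg : sconv sg (Z * g) by exact: sconvM.
have rhoz : 0 <= rho ^+ 2 - modulus z ^+ 2.
  by rewrite subr_ge0 lerXn2r ?nnegrE ?modulus_ge0 ?(ltW rho0).
(* The partial norms increase, so N may be replaced by a larger index at which the truncation term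
   is below e. *)
have hZ N : hardy rho (Y ^+ p * (Z * g)) N <= rho ^+ 2 * B.
  rewrite ZE; apply/ler_addgt0Pr => e e0.
  pose k := rho ^+ 2 * (rho ^+ 2 - modulus z ^+ 2).
  have k0 : 0 <= k by rewrite mulr_ge0 ?sqr_ge0.
  have e1 : 0 < e / (k + 1) by rewrite divr_gt0 // ltr_wpDl.
  have /cvgrPdist_lt/(_ _ e1)[N0 _ hN0] := hardy_cvg0 cG sgr rho0 rhor.
  pose N1 := maxn N N0; have /= := hN0 N1 (leq_maxr _ _).
  rewrite sub0r normrN ger0_norm; last by rewrite mulr_ge0 ?sqr_ge0 ?exprn_ge0 ?ltW.
  rewrite ltr_pdivlMr ?ltr_wpDl // mulrDr mulr1 => hk.
  apply: le_trans (hardy_mono _ (ltW rho0) (leq_maxl N N0)) _.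
  rewrite -/N1 hardy_blaschke lerD //.
    by rewrite -YE ler_wpM2l ?sqr_ge0.
  rewrite -/k mulrC; apply: le_trans (ltW hk).
  by rewrite lerDl mulr_ge0 ?sqr_ge0 ?exprn_ge0 ?ltW.
have := IH (Z * g) _ cZg hZ; rewrite ZE YE.
have -> : coefs (Z * G) 0%N = (rho ^+ 2)%:C%C * coefs G 0%N.
  by rewrite mulrBl -mulrA coefsD coefsN coefs_mulX coefs_mulC subr0.
have -> : coefs (Y * G) 0%N = - (z * coefs G 0%N).
  by rewrite mulrBl coefsD coefsN coefs_mulX coefs_mulC sub0r.
rewrite modulusN !modulusM modulus_of_real ger0_norm ?sqr_ge0 //.
set t := modulus (coefs G 0%N) => h.
have rho2 : 0 < rho ^+ 2 by rewrite exprn_gt0.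
rewrite -(ler_pM2l rho2).
have := ler_wpM2l (sqr_ge0 (modulus z)) h; rewrite !exprS.
set u := _ ^+ p; set v := _ ^+ p; move=> h1.
by apply: le_trans (le_trans h1 _); rewrite le_eqVlt; apply/orP; left; apply/eqP; ring.
Qed.

Lemma sconv_XBX z p : sconv sg ((fpsX C - fpsC z) ^+ p).
Proof.
elim: p => [|p IH]; first exact: sconv1.
by rewrite exprS; apply: sconvM => //; exact: sconvXB.
Qed.

(** Otherwise X - z could be divided out for ever, and [blaschke_bound] with p tending to infinity
    would make the constant coefficient vanish. *)
Lemma zero_order a z : sconv sg a -> indisc sg z -> coefs a 0%N != 0 ->
  exists p, exists2 b, sconv sg b &
    a = (fpsX C - fpsC z) ^+ p * b /\ ceval b z != 0.
Proof.
move=> ca dz a0; apply: contrapT => no.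
have div p : exists2 b, sconv sg b & a = (fpsX C - fpsC z) ^+ p * b.
  elim: p => [|p [b cb ab]]; first by exists a; rewrite ?expr0 ?mul1r.
  exists (fps_div b z); first exact: sconv_div.
  have [bz|bz] := eqVneq (ceval b z) 0; last by case: no; exists p, b.
  rewrite exprSr -mulrA {1}ab; congr (_ * _).
  have {1}-> := fps_divE sg_ge0 cb dz; by rewrite bz fpsC0 add0r.
have [r sgr zr] := indisc_radius dz.
have r0 : 0 < r by rewrite (le_lt_trans sg_ge0).
(* Any radius strictly between |z| and 1/r will do: |z| / rho < 1 gives the decay in p, and rho r <
   1 keeps the Hardy norm finite. *)
pose rho := (modulus z + r^-1) / 2%:R.
have /midf_lt[zrho rhor] : modulus z < r^-1 by rewrite -(ltr_pM2r r0) mulVf ?gt_eqF.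
rewrite -/rho in zrho rhor; move: rho zrho rhor => rho zrho rhor.
have rho0 : 0 < rho by rewrite (le_lt_trans (modulus_ge0 z)).
have {}rhor : rho * r < 1 by rewrite -(ltr_pM2r r0) mulVf ?gt_eqF in rhor.
have [B hB] := hardy_bounded ca sgr rho0 rhor.
have bnd p : modulus (coefs a 0%N) ^+ 2 <= geometric B ((modulus z / rho) ^+ 2) p.
  have [b cb ab] := div p.
  have := @blaschke_bound rho r z p b B sgr rho0 rhor (ltW zrho) cb.
  rewrite -ab => /(_ hB) h; rewrite /= !expr_div_n mulrA.
  by rewrite ler_pdivlMr ?exprn_gt0 // [leLHS]mulrC [leRHS]mulrC.
have q1 : `|(modulus z / rho) ^+ 2| < 1.
  rewrite ger0_norm ?sqr_ge0 // expr_lt1 ?divr_ge0 ?modulus_ge0 ?ltW //.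
  by rewrite ltr_pdivrMr // mul1r.
have /cvgrPdist_lt/(_ (modulus (coefs a 0%N) ^+ 2)) := @cvg_geometric _ B _ q1.
rewrite exprn_gt0 ?modulus_gt0 // => /(_ isT)[N _ /(_ N (leqnn N))] /=.
rewrite sub0r normrN => /(le_lt_trans (ler_norm _)); rewrite ltNge.
by have /= -> := bnd N.
Qed.

End ZeroOrder.

(** * The fraction H/D as a meromorphic function *)

Section Quotient.
Variables (R : realType) (sg : R).
Local Notation C := (cplx R).
Hypothesis sg_ge0 : 0 <= sg.
Variables D E H : fps C.
Hypotheses (DE : D * E = 1) (D0 : coefs D 0%N != 0).
Hypotheses (cD : sconv sg D) (cH : sconv sg H).
Implicit Types (A B : fps C) (z w : C).

Definition frac A B := [/\ sconv sg A, sconv sg B & A * D = B * H].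

(* The value at [z] of the fraction H/D, computed from any representation A/B
   whose denominator does not vanish at [z]. *)
Definition quot z : C :=
  xget 0 [set v | exists A B, frac A B /\ ceval B z != 0 /\ v = ceval A z / ceval B z].

(** The choice made in [quot] is harmless: A D = B H and A' D = B' H give A B' D = A' B D, and D is
    cancelled by its formal inverse [E], even where [E] does not converge. *)
Lemma quotE A B z : indisc sg z -> frac A B -> ceval B z != 0 ->
  quot z = ceval A z / ceval B z.
Proof.
move=> dz [cA cB AB] Bz; rewrite /quot.
case: xgetP => [v _ [A' [B' [[cA' cB' AB'] [Bz' ->]]]]|/(_ (ceval A z / ceval B z))].
  have eq : A * B' = A' * B.
    rewrite -[LHS]mulr1 -[RHS]mulr1 -DE !mulrA; congr (_ * E).
    by rewrite mulrAC AB [RHS]mulrAC AB'; ring.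
  have := congr1 (fun a => ceval a z) eq; rewrite /= !(cevalM sg_ge0) //.
  by move=> e; apply/eqP; rewrite eqr_div // -e.
by case; exists A, B.
Qed.

(** Lowest terms for A / (X - z)^p at z: factors X - z are removed until either the denominator or
    the zeros of the numerator are exhausted. *)
Lemma cancel_XB A z p : sconv sg A -> indisc sg z ->
  exists B k, [/\ sconv sg B,
    B * (fpsX C - fpsC z) ^+ p = (fpsX C - fpsC z) ^+ k * A &
    k = 0%N \/ ceval B z != 0].
Proof.
move=> cA dz; elim: p A cA => [|p IH] A cA.
  by exists A, 0%N; split=> //; [rewrite expr0 mulr1 mul1r|left].
have [Az|Az] := eqVneq (ceval A z) 0; last first.
  by exists A, p.+1; split=> //; [rewrite mulrC|right].
have [B [k [cB BE kB]]] := IH _ (sconv_div sg_ge0 cA dz).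
exists B, k; split=> //.
rewrite {1}(fps_divE sg_ge0 cA dz).
by rewrite Az fpsC0 add0r exprSr mulrA BE -!mulrA [_ * fps_div _ _]mulrC.
Qed.

Lemma frac_near z : indisc sg z -> exists A B k, [/\ frac A ((fpsX C - fpsC z) ^+ k * B),
  sconv sg B, ceval B z != 0 & k = 0%N \/ ceval A z != 0].
Proof.
move=> dz; have [p [D1 cD1 [DE1 D1z]]] := zero_order sg_ge0 cD dz D0.
have [A [k [cA AE kA]]] := cancel_XB p cH dz.
exists A, D1, k; split=> //; split=> //; first by apply: sconvM => //; exact: sconv_XBX.
by rewrite {1}DE1 mulrA AE; ring.
Qed.

Lemma quot_derivable A B z : indisc sg z -> frac A B -> ceval B z != 0 ->
  derivable quot z 1.
Proof.
move=> dz fAB Bz; have [cA cB _] := fAB.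
have : {near z, ceval A \* (fun w => (ceval B w)^-1) =1 quot}.
  have := ceval_near_neq0 sg_ge0 cB dz Bz; have := indisc_near sg_ge0 dz.
  by apply: filterS2 => w dw Bw; rewrite (quotE dw fAB Bw).
move=> /near_eq_derivable; apply.
apply: derivableM; first exact: (ceval_derivable sg_ge0).
by apply: derivableV => //; exact: (ceval_derivable sg_ge0).
Qed.

Lemma quot_holomorphic A B z : indisc sg z -> frac A B -> ceval B z != 0 ->
  holomorphic_at quot z.
Proof.
move=> dz fAB Bz; have [_ cB _] := fAB.
have := ceval_near_neq0 sg_ge0 cB dz Bz; have := indisc_near sg_ge0 dz.
by apply: filterS2 => w dw Bw; exact: quot_derivable fAB Bw.
Qed.

Lemma ceval_XBX_M B k z w : sconv sg B -> indisc sg w ->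
  ceval ((fpsX C - fpsC z) ^+ k * B) w = (w - z) ^+ k * ceval B w.
Proof.
move=> cB dw; elim: k => [|k IH]; first by rewrite !expr0 !mul1r.
rewrite !exprS -!mulrA (ceval_XBM sg_ge0) // ?IH //.
by apply: sconvM => //; exact: sconv_XBX.
Qed.

Lemma quot_pole A B k z : indisc sg z -> frac A ((fpsX C - fpsC z) ^+ k.+1 * B) ->
  sconv sg B -> ceval B z != 0 -> ceval A z != 0 -> pole quot z.
Proof.
move=> dz fAB cB Bz Az; have [cA cYB _] := fAB.
have nB : \forall w \near z^', indisc sg w /\
    ceval ((fpsX C - fpsC z) ^+ k.+1 * B) w != 0.
  rewrite near_withinE; have := ceval_near_neq0 sg_ge0 cB dz Bz.
  have := indisc_near sg_ge0 dz; apply: filterS2 => w dw Bw wz; split; first exact: dw.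
  by rewrite (ceval_XBX_M _ _ cB dw) mulf_neq0 ?expf_neq0 ?subr_eq0.
split; first by apply: filterS nB => w [dw Bw]; exact: quot_derivable fAB Bw.
apply/cvgryPge => M; pose a := modulus (ceval A z) / 2.
have a0 : 0 < a by rewrite divr_gt0 // modulus_gt0.
(* A numerator of modulus at least a over a denominator of modulus below e has modulus at least a /
   e = |M| + 1. *)
pose e := a / (`|M| + 1).
have M1 : 0 < `|M| + 1 by rewrite ltr_wpDl.
have e0 : 0 < e by rewrite divr_gt0.
have B0 : ceval ((fpsX C - fpsC z) ^+ k.+1 * B) z = 0.
  by rewrite ceval_XBX_M // subrr expr0n mul0r.
have /(@cvg_modulusP _ _ (nbhs z))/(_ _ e0) := ceval_continuous sg_ge0 cYB dz.
have /(@cvg_modulusP _ _ (nbhs z))/(_ _ a0) := ceval_continuous sg_ge0 cA dz.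
rewrite B0 => h1 h2.
have {h1 h2} h : \forall w \near z^', a <= modulus (ceval A w) /\
    modulus (ceval ((fpsX C - fpsC z) ^+ k.+1 * B) w) < e.
  apply: nbhs_dnbhs; move: h1 h2; apply: filterS2 => w hA hB.
  split; last by rewrite subr0 in hB.
  have t := modulus_leB (ceval A z) (ceval A w).
  have a2 : modulus (ceval A z) = a + a by rewrite /a; field.
  by rewrite -(lerD2r a) -a2 (le_trans t) // lerD2l ltW.
apply: filterS2 nB h => w [dw Bw] [hA hB].
rewrite (quotE dw fAB Bw) modulusM modulusV ler_pdivlMr ?modulus_gt0 //.
apply: le_trans hA; apply: le_trans (_ : `|M| * e <= _).
  apply: le_trans (ler_wpM2r (modulus_ge0 _) (ler_norm M)) _.
  by rewrite ler_wpM2l // ltW.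
by rewrite /e mulrA ler_pdivrMr // mulrC ler_wpM2l ?(ltW a0) // lerDl.
Qed.

Lemma quot_meromorphic : meromorphic_on (indisc sg) quot.
Proof.
move=> z dz; have [A [B [[|k] [fAB cB Bz kA]]]] := frac_near dz.
  by left; apply: quot_holomorphic fAB _; rewrite // mul1r.
by right; case: kA => // Az; exact: quot_pole fAB cB Bz Az.
Qed.

Lemma quot_pole_at z : indisc sg z ->
  (forall A B, frac A B -> ceval B z = 0) -> pole quot z.
Proof.
move=> dz noB; have [A [B [[|k] [fAB cB Bz kA]]]] := frac_near dz.
  by have := noB _ _ fAB; rewrite mul1r => B0; rewrite B0 eqxx in Bz.
by case: kA => // Az; exact: quot_pole fAB cB Bz Az.
Qed.

End Quotient.

(** * The singularity at 1/s of a series with large nonnegative coefficients *)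

Section Pringsheim.
Variables (R : realType) (sg s : R).
Local Notation C := (cplx R).
Hypotheses (sg_ge0 : 0 <= sg) (sg_s : sg < s).
Variables (D E H : fps C) (u : nat -> nat).
Hypotheses (DE : D * E = 1) (D0 : coefs D 0%N != 0).
Hypotheses (cD : sconv sg D) (cH : sconv sg H) (cE : sconv s E).
Local Notation L := (Fps (fun m => (u m)%:R : C)).
Hypotheses (cL : sconv s L) (LD : L * D = H).
Hypothesis u_ge : forall m, s ^+ m.+1 <= (u m)%:R.

Let s_gt0 : 0 < s. Proof. exact: le_lt_trans sg_s. Qed.
Let s_ge0 : 0 <= s. Proof. exact: ltW. Qed.

Lemma sconv_le (a : fps C) : sconv sg a -> sconv s a.
Proof. by move=> ca r /(lt_trans sg_s); exact: ca. Qed.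

Lemma indisc_le z : indisc s z -> indisc sg z.
Proof. by apply: le_lt_trans; rewrite ler_wpM2l ?modulus_ge0 // ltW. Qed.

Lemma bernoulli_ineq (q : R) N : 0 <= q -> 1 - N%:R * (1 - q) <= q ^+ N.
Proof.
move=> q0; elim: N => [|N IH]; first by rewrite mul0r subr0 expr0.
have := ler_wpM2l q0 IH; rewrite -exprS; apply: le_trans; rewrite -subr_ge0.
have -> : q * (1 - N%:R * (1 - q)) - (1 - N.+1%:R * (1 - q)) = N%:R * (1 - q) ^+ 2.
  by rewrite -natr1; ring.
by rewrite mulr_ge0 // sqr_ge0.
Qed.

(** The terms satisfy u_i x^i >= s (x s)^i. For i < N Bernoulli makes this at least s/2, and the
    remaining terms are nonnegative. *)
Lemma L_large N x : 0 <= x -> x * s < 1 -> N%:R * (1 - x * s) <= 2^-1 ->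
  N%:R * s / 2 <= modulus (ceval L (of_real x)).
Proof.
move=> x0 xs xN.
have dx : indisc s (of_real x) by rewrite /indisc modulus_of_real ger0_norm.
have cx := ceval_cvg s_ge0 cL dx.
apply/ler_addgt0Pr => e e0.
have /(cvg_modulusP)/(_ _ e0)[N0 _ /(_ (maxn N N0) (leq_maxr _ _)) /= h] := cx.
set S := cpseries _ _ _ in h.
have SE : S = of_real (\sum_(0 <= i < maxn N N0) (u i)%:R * x ^+ i).
  rewrite /S /cpseries /series /= /of_real rmorph_sum; apply: eq_bigr => i _.
  by rewrite rmorphM rmorphXn rmorph_nat.
have S_ge : N%:R * s / 2 <= modulus S.
  rewrite SE modulus_of_real; apply: le_trans (ler_norm _).
  rewrite (big_cat_nat (n := N)) ?leq_maxl //=.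
  apply: ler_wpDr; first by apply: sumr_ge0 => i _; rewrite mulr_ge0 // exprn_ge0.
  apply: (@le_trans _ _ (\sum_(0 <= i < N) s / 2)).
    by rewrite big_mkord sumr_const card_ord -[leRHS]mulr_natl mulrA.
  rewrite !big_mkord; apply: ler_sum => i _.
  have xs0 : 0 <= x * s by rewrite mulr_ge0.
  apply: (@le_trans _ _ (s ^+ i.+1 * x ^+ i)); last by rewrite ler_wpM2r ?exprn_ge0.
  rewrite exprS -mulrA -exprMn ler_wpM2l // [s * x]mulrC.
  apply: le_trans (bernoulli_ineq i xs0); rewrite lerBrDr -lerBrDl.
  apply: le_trans (_ : N%:R * (1 - x * s) <= _).
    by rewrite ler_wpM2r ?subr_ge0 ?(ltW xs) // ler_nat ltnW.
  by apply: le_trans xN _; lra.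
apply: le_trans S_ge _; have := modulusD (S - ceval L (of_real x)) (ceval L (of_real x)).
rewrite subrK => /le_trans; apply; rewrite addrC lerD2l; exact: ltW.
Qed.

Let z0 : C := of_real s^-1.

Let dz0 : indisc sg z0.
Proof.
by rewrite /indisc modulus_of_real gtr0_norm ?invr_gt0 // mulrC ltr_pdivrMr // mul1r.
Qed.

(* L >= s / (1 - s x) on [0, 1/s) is unbounded, so no fraction A/B equal to L
   there can have a nonzero denominator at 1/s. *)
Lemma frac_denominator_eq0 A B : frac sg D H A B -> ceval B z0 = 0.
Proof.
move=> [cA cB AB]; apply/eqP/negP => /negP Bz.
have AL : A = B * L.
  rewrite -[LHS]mulr1 -[RHS]mulr1 -DE !mulrA; congr (_ * E).
  by rewrite AB -LD mulrA.
pose b := modulus (ceval B z0) / 2.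
have b0 : 0 < b by rewrite divr_gt0 // modulus_gt0.
have /(@cvg_modulusP _ _ (nbhs z0))/(_ _ b0)/near_modulusP[d1 d10 hB] :=
  ceval_continuous sg_ge0 cB dz0.
have /(@cvg_modulusP _ _ (nbhs z0))/(_ _ ltr01)/near_modulusP[d2 d20 hA] :=
  ceval_continuous sg_ge0 cA dz0.
pose K := modulus (ceval A z0) + 1.
(* This N makes b (N s / 2) > K, where near 1/s the modulus of B is at least b and that of A at most
   K. *)
have [N NK] : exists N, K / b / s * 2 < N%:R.
  by exists (Num.truncn (K / b / s * 2)).+1; rewrite truncnS_gt.
have N0 : (0 < N%:R :> R).
  apply: le_lt_trans NK; rewrite !mulr_ge0 ?invr_ge0 ?(ltW b0) //.
  by rewrite addr_ge0 ?modulus_ge0.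
(* The distance from x to 1/s: small enough for both continuity estimates, for x >= 0, and for N d s
   <= 1/2 as [L_large] requires. The factor 1/2 makes the inequalities strict. *)
pose d := Num.min (Num.min d1 d2) (Num.min (s^-1) ((2 * N%:R * s)^-1)) / 2.
have m0 : 0 < Num.min (Num.min d1 d2) (Num.min (s^-1) ((2 * N%:R * s)^-1)).
  by rewrite !lt_min d10 d20 !invr_gt0 !mulr_gt0 //= s_gt0.
have d0 : 0 < d by rewrite divr_gt0.
have : d < Num.min (Num.min d1 d2) (Num.min (s^-1) ((2 * N%:R * s)^-1)).
  by rewrite /d ltr_pdivrMr // ltr_pMr // ltr1n.
rewrite !lt_min => /andP[/andP[dd1 dd2] /andP[ds dN]].
pose x := s^-1 - d.
have x0 : 0 <= x by rewrite subr_ge0 ltW.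
have xsE : x * s = 1 - d * s by rewrite mulrBl mulVf // gt_eqF.
have xs : x * s < 1 by rewrite xsE ltrBlDr ltrDl mulr_gt0.
have dist : modulus (of_real x - z0) = d.
  have -> : of_real x - z0 = of_real (x - s^-1) by rewrite /z0 /of_real -rmorphB.
  by rewrite modulus_of_real /x addrAC subrr sub0r normrN gtr0_norm.
have xN : N%:R * (1 - x * s) <= 2^-1.
  rewrite xsE opprB addrC subrK.
  move: dN; rewrite -[_^-1]mul1r ltr_pdivlMr ?mulr_gt0 // => dN.
  rewrite -[leRHS]mul1r ler_pdivlMr // ltW //.
  by move: dN; congr (_ < _); ring.
have big := L_large x0 xs xN.
have dx : indisc s (of_real x) by rewrite /indisc modulus_of_real ger0_norm.
have := congr1 (fun a => modulus (ceval a (of_real x))) AL.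
rewrite /= (cevalM s_ge0) // ?modulusM; [|exact: sconv_le].
have /hB hBx : modulus (of_real x - z0) < d1 by rewrite dist.
have /hA hAx : modulus (of_real x - z0) < d2 by rewrite dist.
have Bx : b <= modulus (ceval B (of_real x)).
  have t := modulus_leB (ceval B z0) (ceval B (of_real x)).
  have b2 : modulus (ceval B z0) = b + b by rewrite /b; field.
  by rewrite -(lerD2r b) -b2 (le_trans t) // lerD2l ltW.
have Ax : modulus (ceval A (of_real x)) <= K.
  rewrite -(subrK (ceval A z0) (ceval A _)) (le_trans (modulusD _ _)) //.
  by rewrite addrC lerD2l ltW.
move=> e; move: Ax; rewrite e leNgt => /negP; apply.
apply: lt_le_trans (ler_pM (ltW b0) _ Bx big).
  have -> : K = (K / b / s * 2) * (b * s / 2) by field; rewrite !gt_eqF.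
  have -> : b * (N%:R * s / 2) = N%:R * (b * s / 2) by ring.
  have w0 : 0 < b * s / 2 by rewrite divr_gt0 // mulr_gt0.
  by rewrite (ltr_pM2r w0); exact: NK.
by rewrite !mulr_ge0.
Qed.

(** H/D is itself one of the fractions covered by [frac_denominator_eq0]. *)
Lemma D_root : ceval D z0 = 0.
Proof. by apply: (@frac_denominator_eq0 H); split=> //; rewrite mulrC. Qed.

Lemma D_neq0 z : indisc s z -> ceval D z <> 0.
Proof.
move=> dz Dz; have := congr1 (fun a => ceval a z) DE.
rewrite /= (cevalM s_ge0) ?Dz ?mul0r //; last exact: sconv_le.
by rewrite (cevalC 1) => /eqP; rewrite eq_sym oner_eq0.
Qed.

Lemma quot_extends z : indisc s z -> quot sg D H z = ceval L z.
Proof.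
move=> dz; have Dz := D_neq0 dz.
rewrite (@quotE _ sg sg_ge0 D E H DE H D) //; last 3 first.
- exact: indisc_le.
- by split=> //; rewrite mulrC.
- exact/eqP.
by rewrite -LD (cevalM s_ge0 cL (sconv_le cD) dz) mulfK //; exact/eqP.
Qed.

Lemma quot_pole_inv : pole (quot sg D H) z0.
Proof.
apply: (quot_pole_at sg_ge0 DE D0 cD cH dz0) => A B.
exact: frac_denominator_eq0.
Qed.

End Pringsheim.

(** * Growth rates *)

Section Growth.
Variables (R : realType) (n : nat) (u : nat -> nat).
Hypotheses (n_gt0 : (0 < n)%N) (u_le : forall m, (u m <= n ^ m)%N).

Let v m : R := (u m)%:R `^ (m%:R^-1).

Let root_le (m : nat) (r : R) : (0 < m)%N -> 0 <= r ->
  (v m <= r) = ((u m)%:R <= r ^+ m).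
Proof.
move=> m0 r0; have vm : v m ^+ m = (u m)%:R.
  by rewrite -powR_mulrn ?powR_ge0 // -powRrM mulVf ?powRr1 // pnatr_eq0 -lt0n.
by rewrite -vm ler_pXn2r // nnegrE ?powR_ge0.
Qed.

Let v_le m : v m <= n%:R.
Proof.
case: m => [|m]; first by rewrite /v invr0 powRr0 ler1n.
by rewrite root_le // -natrX ler_nat.
Qed.

Let v_ub : has_ubound (range v).
Proof. by exists n%:R => _ [m _ <-]; exact: v_le. Qed.

Let v_lb : has_lbound (range v).
Proof. by exists 0 => _ [m _ <-]; exact: powR_ge0. Qed.

Let growthE : growth R u = inf (range (sups v)).
Proof.
apply: (@cvg_lim R^o); first exact: Rhausdorff.
exact: (@cvg_sups_inf R v).
Qed.

Let le_sups k m : (k <= m)%N -> v m <= sups v k.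
Proof.
by move=> km; apply: ub_le_sup; [exact: has_ubound_sdrop|exists m].
Qed.

Let sups_le k r : (forall m, (k <= m)%N -> v m <= r) -> sups v k <= r.
Proof.
move=> h; apply: ge_sup; first by exists (v k), k => /=.
by move=> _ [m /= km <-]; exact: h.
Qed.

Let sups_lb : has_lbound (range (sups v)).
Proof.
exists 0 => _ [k _ <-]; exact: le_trans (powR_ge0 _ _) (le_sups (leqnn k)).
Qed.

Lemma growth_ge0 : 0 <= growth R u.
Proof.
rewrite growthE; apply: lb_le_inf; first by exists (sups v 0%N), 0%N.
by move=> _ [k _ <-]; exact: le_trans (powR_ge0 _ _) (le_sups (leqnn k)).
Qed.

Lemma growth_bound r : growth R u < r ->
  exists M : R, forall m, (u m)%:R <= M * r ^+ m.
Proof.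
move=> ur; have r0 : 0 < r by exact: le_lt_trans growth_ge0 ur.
have [_ [k _ <-] kr] : exists2 y, range (sups v) y & y < r.
  apply: inf_lt; last by rewrite -growthE.
  by exists (sups v 0%N), 0%N.
(* The 1 serves the indices beyond k, where the m-th root is already at most r; the sum dominates
   the finitely many others. *)
exists (1 + \sum_(i < k.+1) (u i)%:R / r ^+ i) => m.
have S0 : 0 <= \sum_(i < k.+1) (u i)%:R / r ^+ i :> R.
  by apply: sumr_ge0 => i _; rewrite divr_ge0 // exprn_ge0 // ltW.
have [km|mk] := ltnP k m.
  apply: (@le_trans _ _ (r ^+ m)); last first.
    by rewrite ler_peMl ?exprn_ge0 ?(ltW r0) // lerDl.
  rewrite -root_le ?(ltW r0) ?(leq_trans _ km) //.
  exact: le_trans (le_sups (ltnW km)) (ltW kr).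
rewrite -ler_pdivrMr ?exprn_gt0 // ler_wpDl //.
rewrite (bigD1 (inord m)) //= inordK // lerDl sumr_ge0 // => i _.
by rewrite divr_ge0 // exprn_ge0 // ltW.
Qed.

(* The constant [M] disappears in the m-th root: absorb it at any radius [r]
   larger than [q]. *)
Lemma growth_le (M q : R) : 0 < q ->
  (forall m, (u m)%:R <= M * q ^+ m) -> growth R u <= q.
Proof.
move=> q0 uM; apply/ler_addgt0Pr => e e0; set r := q + e.
have qr : q < r by rewrite ltrDl.
have r0 : 0 < r := lt_trans q0 qr.
have qr1 : `|q / r| < 1.
  by rewrite ger0_norm ?divr_ge0 ?ltW // ltr_pdivrMr // mul1r.
have /cvgrPdist_lt/(_ _ ltr01)[N _ hN] := @cvg_geometric _ M _ qr1.
rewrite growthE; apply: (@le_trans _ _ (sups v (maxn N 1))).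
  by apply: ge_inf => //; exists (maxn N 1).
apply: sups_le => m; rewrite geq_max => /andP[Nm m0].
rewrite root_le ?(ltW r0) //; apply: le_trans (uM m) _.
rewrite -[leRHS]mul1r -ler_pdivrMr ?exprn_gt0 // -mulrA -expr_div_n.
have := hN m Nm; rewrite /= sub0r normrN => /ltW; apply: le_trans.
exact: ler_norm.
Qed.

End Growth.

(* Fekete's lemma *)
Lemma growth_submul (R : realType) (n : nat) (u : nat -> nat) : (0 < n)%N ->
  (forall m, (u m <= n ^ m)%N) -> (forall m p, (u (m + p) <= u m * u p)%N) ->
  0 < growth R u -> forall m, (0 < m)%N -> growth R u ^+ m <= (u m)%:R.
Proof.
move=> n0 un sub s0 p p0; rewrite leNgt; apply/negP => up.
set s := growth R u in s0 up *.
have p_neq0 : p%:R != 0 :> R by rewrite pnatr_eq0 -lt0n.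
pose t : R := (u p)%:R `^ p%:R^-1.
have tp : t ^+ p = (u p)%:R.
  by rewrite -powR_mulrn ?powR_ge0 // -powRrM mulVf // powRr1.
have ts : t < s.
  by rewrite -(@ltr_pXn2r _ p) ?nnegrE ?powR_ge0 ?tp // ltW.
(* Writing m = k p + i with i < p gives u m <= (u p)^k (u i), where (u p)^k = t^(k p) <= q^(k p) and
   the finitely many u i go into a constant. Hence the growth rate is at most q < s, a
   contradiction. *)
have [tq qs] := midf_lt ts; set q := (t + s) / 2%:R in tq qs.
have q0 : 0 < q by rewrite (le_lt_trans (powR_ge0 _ _) tq).
suff : growth R u <= q by rewrite leNgt qs.
have S0 : 0 <= \sum_(i < p) (u i)%:R / q ^+ i :> R.
  by apply: sumr_ge0 => i _; rewrite divr_ge0 // exprn_ge0 // ltW.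
apply: (@growth_le _ n u n0 un (\sum_(i < p) (u i)%:R / q ^+ i)) => // m.
rewrite (divn_eq m p).
have le_k k i : (u (k * p + i) <= u p ^ k * u i)%N.
  elim: k => [|k IH]; first by rewrite mul0n add0n expn0 mul1n.
  rewrite mulSn -addnA expnS -mulnA; apply: leq_trans (sub _ _) _.
  by rewrite leq_mul2l IH orbT.
apply: (@le_trans _ _ ((u p)%:R ^+ (m %/ p)%N * (u (m %% p)%N)%:R)).
  by rewrite -natrX -natrM ler_nat.
rewrite exprD mulrCA; apply: ler_pM => //.
  rewrite -tp -exprM mulnC lerXn2r ?nnegrE ?powR_ge0 ?(ltW q0) //.
  exact: ltW.
rewrite -ler_pdivrMr ?exprn_gt0 //.
have mp : (m %% p < p)%N by rewrite ltn_mod.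
rewrite (bigD1 (Ordinal mp)) //= lerDl sumr_ge0 // => i _.
by rewrite divr_ge0 // exprn_ge0 // ltW.
Qed.

(** * Germs and first hits of turning points *)

Lemma big_tuple_cons (V : nmodType) (I : finType) m (f : seq I -> V) :
  \sum_(g : m.+1.-tuple I) f g = \sum_(i : I) \sum_(g : m.-tuple I) f (i :: g).
Proof.
rewrite pair_big /=.
rewrite (reindex (fun p : I * m.-tuple I => cons_tuple p.1 p.2)) //=.
exists (fun g : m.+1.-tuple I => (thead g, behead_tuple g)) => [[i g] _|g _] /=.
  by congr (_, _); apply: val_inj.
by rewrite [g in RHS]tuple_eta.
Qed.

Lemma big_tuple_rcons (V : nmodType) (I : finType) m (f : seq I -> V) :
  \sum_(g : m.+1.-tuple I) f g =
  \sum_(g : m.-tuple I) \sum_(i : I) f (rcons g i).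
Proof.
elim: m f => [|m IH] f.
  by rewrite big_tuple_cons exchange_big; apply: eq_bigr => g _; rewrite tuple0.
rewrite big_tuple_cons (big_tuple_cons m (fun g => \sum_(i : I) f (rcons g i))).
by apply: eq_bigr => i _; rewrite (IH (fun g => f (i :: g))).
Qed.

Lemma nth_lt_count (R : realType) (P : pred R) (t : seq R) i :
  (forall x y, x <= y -> P y -> P x) -> sorted <%R t -> (i < size t)%N ->
  P (nth 0 t i) = (i < count P t)%N.
Proof.
move=> Pmono; elim: t i => [|a t IH] i //= at_sorted.
have t_sorted := path_sorted at_sorted.
have [Pa|nPa] := boolP (P a).
  by case: i => [|i] //= it; rewrite IH.
have -> : count P t = 0%N.
  apply/eqP; rewrite -leqn0 leqNgt -has_count; apply/hasPn => y yt.
  apply: contra nPa; apply: Pmono.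
  by have /allP/(_ _ yt)/ltW := order_path_min lt_trans at_sorted.
case: i => [|i] //= it; first exact/negbTE.
rewrite ltn0; apply/negbTE; apply: contra nPa; apply: Pmono.
by have /allP/(_ _ (mem_nth 0 it))/ltW := order_path_min lt_trans at_sorted.
Qed.

Section Germs.
Variables (R : realType) (n : nat) (F : system R n).
Implicit Types (p q : R * bool) (r : 'I_n) (g h : seq 'I_n) (x y c : R).
Local Notation tp := (turning_points F).

(* The pair (x, true) stands for the right germ x+ and (x, false) for the left
   germ x-; germs are ordered by x- < x+ < y-  for x < y, and [below c p] says
   that the point c lies below the germ p. *)
Definition below c p : bool := if p.2 then c <= p.1 else c < p.1.

Definition side p : set_system R := if p.2 then at_right p.1 else at_left p.1.

Definition inc r : bool :=
  `[< {in fn_dom F r &, {homo fn F r : x y / x < y}} >].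

(** Membership of the points close to [p] on its side; at an end of the interval only the inner germ
    qualifies. *)
Definition gmem r p : bool := below (lo F r) p && ~~ below (hi F r) p.

(** A decreasing map exchanges left and right germs. *)
Definition gstep r p : R * bool := (fn F r p.1, p.2 == inc r).

Fixpoint gfn g p := if g is r :: g' then gfn g' (gstep r p) else p.

Fixpoint gdom g p :=
  if g is r :: g' then gmem r p && gdom g' (gstep r p) else true.

Global Instance side_filter p : ProperFilter (side p).
Proof. by case: p => x [] /=; rewrite /side /=; typeclasses eauto. Qed.

Lemma sideP p (P : R -> Prop) : (\forall y \near side p, P y) <->
  exists2 e : R, 0 < e & forall y, y != p.1 -> (p.1 < y) = p.2 ->
    `|y - p.1| < e -> P y.
Proof.
case: p => x [] /=; rewrite /side /=; split.
- rewrite /at_right near_withinE => /nbhs_normP[e /= e0 h]; exists e => // y yx xy d.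
  by apply: h => //; rewrite /= distrC.
- case=> e e0 h; rewrite /at_right near_withinE; apply/nbhs_normP; exists e => //.
  move=> y /= d xy; apply: h; rewrite ?gt_eqF //; last by rewrite distrC.
- rewrite /at_left near_withinE => /nbhs_normP[e /= e0 h]; exists e => // y yx xy d.
  apply: h; first by rewrite /= distrC.
  by rewrite lt_neqAle yx leNgt xy.
- case=> e e0 h; rewrite /at_left near_withinE; apply/nbhs_normP; exists e => //.
  move=> y /= d xy; apply: h; rewrite ?lt_eqF //; last by rewrite distrC.
  by apply/negbTE; rewrite -leNgt ltW.
Qed.

Lemma near_below c p : \forall y \near side p, y != c /\ (c < y) = below c p.
Proof.
apply/sideP; case: p => x b; rewrite /below /=.
have [->|cx] := eqVneq c x.
  exists 1 => // y yx; case: b => xy _; split=> //; first by rewrite xy lexx.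
  by rewrite xy ltxx.
have cx0 : 0 < `|x - c| by rewrite normr_gt0 subr_eq0 eq_sym.
exists `|x - c| => // y yx xy d; split.
  by apply/eqP => yc; rewrite yc distrC ltxx in d.
have -> : (if b then c <= x else c < x) = (c < x).
  by case: (b) => //; rewrite le_eqVlt (negbTE cx).
move: d; have [cltx|xltc|e] := ltgtP c x; last by rewrite e eqxx in cx.
- by rewrite [`|x - c|]gtr0_norm ?subr_gt0 // ltr_norml opprB ltrD2r => /andP[-> _].
- rewrite [`|x - c|]ltr0_norm ?subr_lt0 // opprB ltr_norml ltrD2r => /andP[_ d].
  by apply/negbTE; rewrite -leNgt ltW.
Qed.

Lemma near_belows (s : seq R) p :
  \forall y \near side p, {in s, forall c, y != c /\ (c < y) = below c p}.
Proof.
elim: s => [|c s IH]; first by apply: nearW => y c.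
apply: filterS2 (near_below c p) IH => y h1 h2 c'.
by rewrite inE => /predU1P[->//|]; exact: h2.
Qed.

Lemma below_germ c y b : (y == c) = false -> below c (y, b) = (c < y).
Proof. by move=> yc; case: b; rewrite /below //= le_eqVlt eq_sym yc. Qed.

Lemma below_le c c' p : c <= c' -> below c' p -> below c p.
Proof.
by case: p => x [] cc; rewrite /below /=; [exact: le_trans|exact: le_lt_trans].
Qed.

Lemma near_gmem r p : gmem r p ->
  \forall y \near side p, lo F r < y < hi F r.
Proof.
move=> /andP[h1 h2]; apply: filterS2 (near_below (lo F r) p) (near_below (hi F r) p).
move=> y [_ ->] [yhi e]; rewrite h1 /= lt_neqAle yhi leNgt e.
exact: h2.
Qed.

Lemma near_ngmem r p : ~~ gmem r p ->
  \forall y \near side p, ~~ (lo F r <= y <= hi F r).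
Proof.
move=> nm; apply: filterS2 (near_below (lo F r) p) (near_below (hi F r) p).
move=> y [ylo elo] [yhi ehi]; apply: contra nm => /andP[h1 h2].
by rewrite /gmem -elo -ehi -leNgt h2 lt_neqAle eq_sym ylo h1.
Qed.

Lemma gmem_itv r p : gmem r p -> p.1 \in fn_dom F r.
Proof.
case: p => x [] /andP[]; rewrite /below /= in_itv /= -?ltNge -?leNgt => h1 h2.
  by rewrite h1 ltW.
by rewrite h2 ltW.
Qed.

Lemma gmem_interior r x b : lo F r < x < hi F r -> gmem r (x, b).
Proof.
move=> /andP[h1 h2]; rewrite /gmem (below_germ _ (gt_eqF h1)).
by rewrite (below_germ _ (lt_eqF h2)) h1 -leNgt ltW.
Qed.

Lemma gmem_exterior r y b : ~~ (lo F r <= y <= hi F r) -> ~~ gmem r (y, b).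
Proof.
by apply: contra => /gmem_itv; rewrite in_itv.
Qed.

Lemma fn_mono r : {in fn_dom F r &, forall x y, x < y ->
  (fn F r x < fn F r y) = inc r /\ fn F r x != fn F r y}.
Proof.
move=> x y xI yI xy; rewrite /inc; case: asboolP => h.
  by have := h _ _ xI yI xy => /[dup] /lt_eqF -> ->.
have [//|h'] := fn_monotone F r.
have fyx := h' y x yI xI xy.
by rewrite gt_eqF // ltNge le_eqVlt fyx orbT.
Qed.

Lemma fn_inj r : {in fn_dom F r &, injective (fn F r)}.
Proof.
move=> x y xI yI fxy; have [xy|yx|//] := ltgtP x y.
  by have [_] := fn_mono xI yI xy; rewrite fxy eqxx.
by have [_] := fn_mono yI xI yx; rewrite fxy eqxx.
Qed.

(** Continuity gives closeness to the image point, and strict monotonicity keeps the image off that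
    point and on the side predicted by [gstep]. *)
Lemma gstep_cvg r p : gmem r p -> fn F r @ side p --> side (gstep r p).
Proof.
move=> m P /sideP[e e0 hP]; have xI := gmem_itv m.
have : {within `[lo F r, hi F r], continuous (fn F r)} := @fn_continuous _ _ F r.
move=> /subspace_continuousP/(_ p.1 xI)/cvgrPdist_lt/(_ _ e0).
rewrite near_withinE => /nbhs_normP[d /= d0 hd].
have : \forall y \near side p, `|y - p.1| < d /\ y != p.1 /\ (p.1 < y) = p.2.
  by apply/sideP; exists d.
have := near_gmem m; apply: filterS2 => y /andP[y1 y2] [yd [yx xy]].
have yI : y \in fn_dom F r by rewrite in_itv /= !ltW.
have [fy1 fy2] : fn F r y != fn F r p.1 /\ (fn F r p.1 < fn F r y) = (gstep r p).2.
  rewrite /gstep /= -xy; have [lt|gt|e1] := ltgtP p.1 y; last by rewrite e1 eqxx in yx.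
    by have [-> ne] := fn_mono xI yI lt; rewrite eq_sym.
  have [lt ne] := fn_mono yI xI gt; split=> //; rewrite -lt.
  by rewrite ltNge le_eqVlt (negbTE ne) /=; case: (_ < _).
apply: hP => //=; rewrite distrC; apply: hd => //=; by rewrite distrC.
Qed.

(** Continuity into a discrete space for the order topology on germs: only points on the side of [p]
    count, but both of their germs must give the value at [p]. *)
Definition locally_constant (T : Type) (f : R * bool -> T) :=
  forall p, \forall y \near side p, forall b, f (y, b) = f p.

Lemma locally_constant_step (T : Type) (f : R * bool -> T) (d : T) r :
  locally_constant f ->
  locally_constant (fun p => if gmem r p then f (gstep r p) else d).
Proof.
move=> lf p; case: ifP => [m|/negbT nm].
  have := gstep_cvg m (lf _); have := near_gmem m.
  by apply: filterS2 => y hy hf b; rewrite gmem_interior // hf.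
by apply: filterS (near_ngmem nm) => y hy b; rewrite (negbTE (gmem_exterior _ hy)).
Qed.

Lemma locally_constant_word (T : Type) (f : R * bool -> T) (d : T) g :
  locally_constant f ->
  locally_constant (fun p => if gdom g p then f (gfn g p) else d).
Proof.
move=> lf; elim: g => [|r g IH] //= p.
have := locally_constant_step d r IH p; apply: filterS => y hy b.
by move: (hy b); rewrite /=; case: gmem; case: gmem.
Qed.

Lemma locally_constant_below c : locally_constant (below c).
Proof. by move=> p; apply: filterS (near_below c p) => y [/negbTE yc <-] b; rewrite below_germ. Qed.

(** The index j of the interval P_j in which the germ lies. *)
Definition gindex p : nat := count (below^~ p) tp.

Lemma locally_constant_gindex : locally_constant gindex.
Proof.
move=> p; apply: filterS (near_belows tp p) => y hy b.
by apply: eq_in_count => c /hy[/negbTE yc <-]; rewrite below_germ.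
Qed.

Lemma locally_constant2 (T T1 T2 : Type) (h : T1 -> T2 -> T) f1 f2 :
  locally_constant f1 -> locally_constant f2 ->
  locally_constant (fun p => h (f1 p) (f2 p)).
Proof.
by move=> l1 l2 p; apply: filterS2 (l1 p) (l2 p) => y h1 h2 b; rewrite h1 h2.
Qed.

Lemma locally_constant_sum (V : nmodType) (I : finType) (f : I -> R * bool -> V) :
  (forall i, locally_constant (f i)) ->
  locally_constant (fun p => \sum_(i : I) f i p).
Proof.
move=> lf p; have : \forall y \near side p, forall i, i \in enum I ->
    forall b, f i (y, b) = f i p.
  elim: (enum I) => [|i s IH]; first by apply: nearW.
  apply: filterS2 (lf i p) IH => y h1 h2 j.
  by rewrite inE => /predU1P[->//|]; exact: h2.
by apply: filterS => y h b; apply: eq_bigr => i _; rewrite h // mem_enum.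
Qed.

(** Without jumps the two germs of each point can be glued, and a locally constant function on the
    connected line is constant. *)
Lemma locally_constant_eq (T : Type) (f : R * bool -> T) :
  locally_constant f -> (forall x, f (x, true) = f (x, false)) ->
  forall p q, f p = f q.
Proof.
move=> lf jump.
have fb x b : f (x, b) = f (x, true) by case: b.
have near_f x : \forall y \near x, f (y, true) = f (x, true).
  have /sideP[e1 e10 h1] := lf (x, true).
  have /sideP[e2 e20 h2] := lf (x, false).
  apply/nbhs_normP; exists (Num.min e1 e2); first by rewrite /= lt_min e10.
  move=> y /=; rewrite distrC lt_min => /andP[d1 d2].
  have [xy|yx|->//] := ltgtP x y.
    by rewrite (h1 y _ _ d1 true) //= ?gt_eqF.
  by rewrite (h2 y _ _ d2 true) ?fb //= ?lt_eqF //; apply/negbTE; rewrite -leNgt ltW.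
move=> [x b] [y b']; rewrite !fb.
have : connected [set: R] by apply/connected_intervalP.
move=> /(_ [set z | f (z, true) = f (y, true)]) h.
suff : [set z | f (z, true) = f (y, true)] = setT.
  by move/seteqP => [_ /(_ x)]; apply.
apply: h; first by exists y.
- exists [set z | f (z, true) = f (y, true)]; last by rewrite setTI.
  by rewrite openE => z /= zy; apply: filterS (near_f z) => w /= ->.
- exists [set z | f (z, true) = f (y, true)]; last by rewrite setTI.
  rewrite -openC openE => z /= zy; apply: filterS (near_f z) => w /= ->.
  exact: zy.
Qed.

End Germs.

Section FirstHits.
Variables (R : realType) (n : nat) (F : system R n).
Implicit Types (p q : R * bool) (r : 'I_n) (g h : seq 'I_n) (x y c : R).
Local Notation tp := (turning_points F).
Local Notation k := (nturn F).

Lemma lo_turning r : lo F r \in tp.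
Proof. by rewrite mem_sort mem_undup mem_cat map_f ?mem_enum. Qed.

Lemma hi_turning r : hi F r \in tp.
Proof. by rewrite mem_sort mem_undup mem_cat [X in _ || X]map_f ?mem_enum ?orbT. Qed.

Lemma turningP c : reflect (exists i : 'I_k, c = cpt F i) (c \in tp).
Proof.
apply: (iffP idP) => [ct|[i ->]]; last exact: mem_nth.
have it : (index c tp < k)%N by rewrite index_mem.
by exists (Ordinal it); rewrite /cpt /= nth_index.
Qed.

Lemma turning_endpoint c : c \in tp -> exists r, c = lo F r \/ c = hi F r.
Proof.
rewrite mem_sort mem_undup mem_cat => /orP[] /mapP[r _ ->]; exists r; by [left|right].
Qed.

Lemma tp_sorted : sorted <%R tp.
Proof. by rewrite sort_lt_sorted undup_uniq. Qed.

Lemma cpt_inj (i j : 'I_k) : cpt F i = cpt F j -> i = j.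
Proof.
move=> e; apply: val_inj; apply/eqP.
have := nth_uniq 0 (ltn_ord i) (ltn_ord j) (lt_sorted_uniq tp_sorted).
by rewrite -[nth 0 _ i]/(cpt F i) e eqxx.
Qed.

Lemma cpt_below i p : (i < k)%N -> below (cpt F i) p = (i < gindex F p)%N.
Proof.
move=> ik; apply: (nth_lt_count (P := fun c => below c p)) => //; last exact: tp_sorted.
by move=> x y xy; exact: below_le.
Qed.

Lemma cpt0_le c : c \in tp -> cpt F 0 <= c.
Proof.
move=> /turningP[i ->]; have i0 : (0 < k)%N by rewrite (leq_ltn_trans _ (ltn_ord i)).
have := cpt_below (cpt F i, true) i0; rewrite /below /= => ->.
have := cpt_below (cpt F i, true) (ltn_ord i); rewrite /below /= lexx => /esym.
exact: leq_trans.
Qed.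

Lemma cpt_last_ge c : c \in tp -> c <= cpt F k.-1.
Proof.
move=> /turningP[i ->]; have k0 : (0 < k)%N by rewrite (leq_ltn_trans _ (ltn_ord i)).
have kk : (k.-1 < k)%N by rewrite prednK.
have := cpt_below (cpt F k.-1, true) (ltn_ord i); rewrite /below /= => ->.
have := cpt_below (cpt F k.-1, true) kk; rewrite /below /= lexx => /esym.
by apply: leq_trans; rewrite ltnS -ltnS prednK.
Qed.

(* [x] is sent to the turning point c_(i+1) along [h] without meeting a turning
   point before. *)
Fixpoint hits (i : 'I_k) h x : bool :=
  if h is r :: h' then [&& x \notin tp, lo F r < x < hi F r & hits i h' (fn F r x)]
  else x == cpt F i.

Lemma hits_inj i h x y : hits i h x -> hits i h y -> x = y.
Proof.
elim: h x y => [|r h IH] x y /=; first by move=> /eqP-> /eqP->.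
move=> /and3P[_ /andP[x1 x2] hx] /and3P[_ /andP[y1 y2] hy].
by apply: (fn_inj _ _ (IH _ _ hx hy)); rewrite in_itv /= !ltW.
Qed.

Lemma hits_gdom i h x b : hits i h x -> gdom F h (x, b).
Proof.
elim: h x b => [|r h IH] x b //= /and3P[_ xr hx].
by rewrite gmem_interior //= IH.
Qed.

Lemma hits_ge i h x : hits i h x -> cpt F 0 <= x.
Proof.
case: h => [/eqP->|r h /and3P[_ /andP[/ltW xlo _] _]].
  by apply: cpt0_le; apply/turningP; exists i.
exact: le_trans (cpt0_le (lo_turning r)) xlo.
Qed.

(** Meant for a [Q] with at most one solution: the step function of the germ that jumps there.
    [hits_inj] provides this for first hits, as each f_r is injective. *)
Definition crossed (Q : R -> Prop) p : bool := `[< exists x, below x p /\ Q x >].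

Lemma locally_constant_crossed (Q : R -> Prop) :
  (forall x y, Q x -> Q y -> x = y) -> locally_constant (crossed Q).
Proof.
move=> Qinj; have [[z Qz]|noQ] := pselect (exists z, Q z).
  have cE p : crossed Q p = below z p.
    apply/asboolP/idP => [[x [xp Qx]]|zp]; last by exists z.
    by rewrite (Qinj z x).
  move=> p; apply: filterS (locally_constant_below z p) => y h b.
  by rewrite !cE.
move=> p; apply: nearW => y b; rewrite /crossed; congr asbool; apply/propext.
by split=> -[x [_ Qx]]; case: noQ; exists x.
Qed.

Lemma crossed_jump (Q : R -> Prop) x : (forall x y, Q x -> Q y -> x = y) ->
  (crossed Q (x, true) = `[< Q x >] + crossed Q (x, false) :> nat)%N.
Proof.
move=> Qinj; have [Qx|nQx] := asboolP (Q x).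
  have -> : crossed Q (x, true) by apply/asboolP; exists x; split=> //; exact: lexx.
  rewrite /crossed; case: asboolP => // -[y [yx Qy]].
  by rewrite /below /= (Qinj y x) ?ltxx in yx.
congr nat_of_bool; rewrite /crossed; congr asbool; apply/propext.
split=> -[y [yx Qy]]; exists y; split=> //; last exact: ltW.
move: yx; rewrite /below /= le_eqVlt => /orP[/eqP yx|//].
by rewrite yx in Qy.
Qed.

(** The coefficient of t^m in the series A_i(p). *)
Definition nhits (i : 'I_k) m p : nat :=
  \sum_(h : m.-tuple 'I_n) crossed (hits i h) p.

Definition hits_at (i : 'I_k) m x : nat := \sum_(h : m.-tuple 'I_n) hits i h x.

Lemma locally_constant_nhits i m : locally_constant (nhits i m).
Proof.
apply: (@locally_constant_sum R nat) => h p.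
have lc := @locally_constant_crossed (hits i h) (@hits_inj i h) p.
by apply: filterS lc => y hy b; rewrite hy.
Qed.

Lemma nhits_jump i m x : nhits i m (x, true) = (hits_at i m x + nhits i m (x, false))%N.
Proof.
rewrite /nhits /hits_at -big_split /=; apply: eq_bigr => h _.
rewrite (@crossed_jump (hits i h)); last exact: hits_inj.
by rewrite asboolb.
Qed.

Lemma nhits_min i m : nhits i m (cpt F 0, false) = 0%N.
Proof.
apply: big1 => h _; rewrite /crossed; case: asboolP => // -[x [xp /hits_ge]].
by rewrite leNgt; rewrite /below /= in xp; rewrite xp.
Qed.

Lemma hits_at0 i x : hits_at i 0 x = (x == cpt F i).
Proof.
rewrite /hits_at (bigD1 (nil_tuple _)) //= big1 ?addn0 // => h.
by rewrite [h]tuple0 eqxx.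
Qed.

Lemma hits_atS i m x : x \notin tp ->
  hits_at i m.+1 x = \sum_(r < n | lo F r < x < hi F r) hits_at i m (fn F r x).
Proof.
move=> xt; rewrite /hits_at (@big_tuple_cons nat _ _ (fun h => nat_of_bool (hits i h x))).
rewrite [RHS]big_mkcond /=; apply: eq_bigr => r _; case: ifP => xr.
  by apply: eq_bigr => h _; rewrite xt.
by rewrite big1 // => h _; rewrite andbF.
Qed.

Lemma hits_atS_turning i m x : x \in tp -> hits_at i m.+1 x = 0%N.
Proof.
move=> xt; rewrite /hits_at (@big_tuple_cons nat _ _ (fun h => nat_of_bool (hits i h x))).
by rewrite !big1 // => r _; rewrite big1 // => h _ /=; rewrite xt.
Qed.

Section Decomposition.
Variables (W : zmodType) (phi : nat -> R * bool -> W).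
Hypothesis n_gt0 : (0 < n)%N.
Hypothesis phi_lc : forall m, locally_constant (phi m).
Hypothesis phi_min : forall m, phi m (cpt F 0, false) = 0.

Definition jump m x := phi m (x, true) - phi m (x, false).

Hypothesis jump0 : forall x, x \notin tp -> jump 0 x = 0.
Hypothesis jumpS : forall m x, x \notin tp ->
  jump m.+1 x = \sum_(r < n | lo F r < x < hi F r) jump m (fn F r x).

(** The recursion [jumpS] is unrolled along each word until a turning point is met; what never meets
    one ends in [jump0] and contributes nothing. *)
Lemma jump_first_hits m x :
  jump m x = \sum_(i < k) \sum_(j < m.+1) jump (m - j) (cpt F i) *+ hits_at i j x.
Proof.
elim: m x => [|m IH] x.
  have [/turningP[i0 ->]|xt] := boolP (x \in tp); last first.
    rewrite jump0 // big1 // => i _; rewrite big_ord1 hits_at0.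
    case: eqP => [xi|]; last by rewrite mulr0n.
    by case/negP: xt; apply/turningP; exists i.
  rewrite (bigD1 i0) //= big_ord1 hits_at0 eqxx mulr1n big1 ?addr0 // => i i_neq.
  rewrite big_ord1 hits_at0; case: eqP => [/cpt_inj e|]; last by rewrite mulr0n.
  by rewrite e eqxx in i_neq.
have [xt|xt] := boolP (x \in tp).
  have /turningP[i0 xE] := xt.
  rewrite (bigD1 i0) //= big_ord_recl subn0 hits_at0 xE eqxx mulr1n.
  rewrite big1 ?addr0 => [|j _]; last by rewrite hits_atS_turning -?xE // mulr0n.
  rewrite big1 ?addr0 // => i i_neq; apply: big1 => -[[|j] jm] _ /=.
    rewrite hits_at0; case: eqP => [/cpt_inj e|]; last by rewrite mulr0n.
    by rewrite e eqxx in i_neq.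
  by rewrite hits_atS_turning -?xE // mulr0n.
rewrite jumpS // (eq_bigr _ (fun r _ => IH (fn F r x))) exchange_big /=.
apply: eq_bigr => i _; rewrite [RHS]big_ord_recl hits_at0.
have -> : (x == cpt F i) = false.
  by apply/eqP => xi; case/negP: xt; apply/turningP; exists i.
rewrite mulr0n add0r exchange_big /=; apply: eq_bigr => j _.
by rewrite hits_atS // sumrMnr.
Qed.

(** The difference of the two sides is locally constant, has no jumps by [jump_first_hits], and
    vanishes at the germ to the left of all turning points. *)
Lemma first_hit_decomposition m p :
  phi m p = \sum_(i < k) \sum_(j < m.+1) jump (m - j) (cpt F i) *+ nhits i j p.
Proof.
apply/eqP; rewrite -subr_eq0; apply/eqP.
pose psi p := phi m p -
  \sum_(i < k) \sum_(j < m.+1) jump (m - j) (cpt F i) *+ nhits i j p.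
rewrite -/(psi p).
have -> : psi p = psi (cpt F 0, false).
  apply: locally_constant_eq => [|x].
    apply: (locally_constant2 (fun a b : W => a - b)) => //.
    apply: locally_constant_sum => i; apply: locally_constant_sum => j q.
    by apply: filterS (locally_constant_nhits i j q) => y hy b; rewrite hy.
  apply/eqP; rewrite -subr_eq0 /psi opprD opprK addrACA -/(jump m x) addrC.
  rewrite jump_first_hits -sumrN -!big_split big1 //= => i _.
  rewrite -sumrN -!big_split big1 //= => j _.
  by rewrite nhits_jump mulrnDr -addrA [X in _ + X]addrC addNr.
rewrite /psi phi_min sub0r big1 ?oppr0 // => i _.
by rewrite big1 // => j _; rewrite nhits_min mulr0n.
Qed.

End Decomposition.
End FirstHits.

(** * The kneading matrix and its inverse *)

(** For the matrix [-e | I]: deleting column 0 leaves the identity. Deleting column j'+1 leaves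
    -e_j' as the only nonzero entry of row j', with an identity as its complementary minor, so the
    two signs combine to (-1)^(j'+1). *)
Lemma det_col'_echelon (K : comNzRingType) k (e : 'I_k -> K)
    (W : 'M[K]_(k, k.+1)) (j : 'I_k.+1) :
  (forall i q, W i q = (q == lift ord0 i)%:R - (q == ord0)%:R * e i) ->
  \det (col' j W) = (-1) ^+ j * (if unlift ord0 j is Some i then e i else 1).
Proof.
move=> WE; case: unliftP => [j' ->|->]; last first.
  rewrite expr0 mul1r; have -> : col' ord0 W = 1%:M :> 'M[K]_k; last exact: det1.
  apply/matrixP => a b.
  rewrite !mxE WE (inj_eq lift_inj) [lift _ _ == ord0]eq_sym (negbTE (neq_lift _ _)).
  by rewrite mul0r subr0 eq_sym.
case: k e W j j' WE => [|k] e W j j' WE; first by case: j'.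
rewrite (expand_det_row _ j') (bigD1 ord0) //= big1 ?addr0 => [|q q0].
  rewrite !mxE !WE eq_sym (negbTE (neq_lift _ _)) mulr0n sub0r.
  have -> : lift (lift ord0 j') ord0 = ord0 :> 'I_k.+2 by apply: val_inj.
  rewrite eqxx mul1r /cofactor addn0 (_ : row' _ _ = 1%:M).
    by rewrite det1 mulr1 mulNr mulrC -mulNr exprS mulN1r.
  apply/matrixP => a b; rewrite !mxE WE.
  have -> : lift (lift ord0 j') (lift ord0 b) = lift ord0 (lift j' b).
    by apply: val_inj; rewrite /= /bump /= !add1n ltnS; case: leqP.
  rewrite !(inj_eq lift_inj) [lift _ _ == ord0]eq_sym (negbTE (neq_lift _ _)).
  by rewrite mul0r subr0 eq_sym.
rewrite !mxE WE eq_sym (negbTE (neq_lift _ _)) (_ : _ == ord0 = false).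
  by rewrite mul0r subr0 mul0r.
apply/eqP => /(congr1 val) /=; rewrite /bump /= add1n.
move: q0; rewrite -val_eqE /=.
by case: (nat_of_ord q) => [|q'] // _; rewrite addnS.
Qed.

Section Kneading.
Variables (R : realType) (n : nat) (F : system R n).
Implicit Types (p : R * bool) (r : 'I_n) (g h : seq 'I_n) (x y c : R).
Local Notation tp := (turning_points F).
Local Notation k := (nturn F).

(** The bridge from points to germs: since images of nearby points avoid the turning points, the
    averaged symbols in [Dsym] never occur in a one-sided limit. *)
Lemma near_word_germ g p : \forall y \near side p,
  (in_dom F g y <-> gdom F g p) /\
  (gdom F g p -> word_fn F g y \notin tp /\
     gindex F (word_fn F g y, true) = gindex F (gfn F g p)).
Proof.
elim: g p => [|r g IH] p /=.
  apply: filterS2 (near_belows tp p) (locally_constant_gindex F p) => y h1 h2.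
  split=> // _; rewrite h2; split=> //; apply/negP => /h1[].
  by rewrite eqxx.
case: (boolP (gmem F r p)) => [m|nm] /=; last first.
  apply: filterS (near_ngmem nm) => y hy; split=> //; split=> // -[].
  by rewrite in_itv /= (negbTE hy).
have := gstep_cvg m (IH (gstep F r p)); have := near_gmem m.
apply: filterS2 => y /andP[y1 y2] [h1 h2]; split=> //.
by rewrite in_itv /= !ltW //; split=> [[_ /h1]|/h1 ?].
Qed.

(** The domain contains a one-sided neighbourhood of x. Thus the condition [fat] in [theta] holds by
    itself near a germ. *)
Lemma gdom_fat g p : gdom F g p -> fat F g.
Proof.
case: p => x b gp; have : \forall y \near side (x, b), in_dom F g y.
  by apply: filterS (near_word_germ g (x, b)) => y [[_ h] _]; exact: h.
move=> /sideP[e e0 h]; exists (if b then x + e / 2 else x - e / 2).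
apply/nbhs_normP; exists (e / 2); first by rewrite /= divr_gt0.
move=> y /=; rewrite distrC ltr_norml => /andP[y1 y2]; rewrite /= in h.
case: b gp h y1 y2 => gp h y1 y2.
  have xy : x < y by lra.
  by apply: h; rewrite ?gt_eqF // gtr0_norm ?subr_gt0 //; lra.
have yx : y < x by lra.
apply: h; rewrite ?lt_eqF //; first by apply/negbTE; rewrite -leNgt ltW.
by rewrite ltr0_norm ?subr_lt0 //; lra.
Qed.

Lemma interior_gdom g x b : (Dom F g)° x -> gdom F g (x, b).
Proof.
move=> /nbhs_normP[e e0 h]; have := near_word_germ g (x, b).
have : \forall y \near side (x, b), in_dom F g y.
  by apply/sideP; exists e => //= y _ _ d; apply: h; rewrite /= distrC.
move=> h1 h2; have [y [Dy [[]]]] := filter_ex (filterI h1 h2).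
by move=> /(_ Dy).
Qed.

Definition gsymbol p : 'I_k.+1 := inord (gindex F p).

Lemma gindex_le p : (gindex F p < k.+1)%N.
Proof. by rewrite ltnS count_size. Qed.

Lemma Pitv_germ y (j : 'I_k.+1) : y \notin tp ->
  (y \in Pitv j) = (j == gsymbol (y, true)).
Proof.
move=> yt; rewrite -val_eqE /= inordK ?gindex_le //.
have ge_idx i : (i < k)%N -> (y <= cpt F i) = (gindex F (y, true) <= i)%N.
  move=> ik; have := cpt_below (y, true) ik; rewrite /below /= => ciy.
  rewrite leqNgt -ciy -ltNge le_eqVlt; case: eqP => // yi.
  by case/negP: yt; rewrite yi mem_nth.
have := gindex_le (y, true); rewrite ltnS => idxk.
have -> : (j == gindex F (y, true) :> nat)
    = (if val j is j'.+1 then cpt F j' <= y else true) &&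
      (if (j < k)%N then y <= cpt F j else true).
  have -> : (if val j is j'.+1 then cpt F j' <= y else true)
      = (j <= gindex F (y, true))%N.
    case: (j) => [[|j'] j'k] //=.
    by have := cpt_below (y, true) (j'k : (j' < k)%N); rewrite /below.
  rewrite eqn_leq; congr (_ && _); case: ifP => [/ge_idx->//|/negbT].
  by rewrite -leqNgt => /(leq_trans idxk).
by rewrite in_itv; case: (j) => [[|j'] jk] /=; case: ifP => _; rewrite ?andbT.
Qed.

Lemma Dsym_germ y : y \notin tp -> Dsym F y = delta_mx 0 (gsymbol (y, true)).
Proof.
move=> yt; rewrite /Dsym (negbTE yt) scale1r.
under eq_bigl do rewrite Pitv_germ //.
by rewrite big_pred1_eq.
Qed.

(** The coefficient of t^m in the one-sided limit of [theta] at the germ, as [theta_lim]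
    confirms. *)
Definition Theta m p : symV F := \sum_(g : m.-tuple 'I_n)
  if gdom F g p then word_sign F g *: delta_mx 0 (gsymbol (gfn F g p)) else 0.

Lemma near_theta m p : \forall y \near side p, theta F y m = Theta m p.
Proof.
have : \forall y \near side p, forall g : m.-tuple 'I_n,
    (in_dom F g y <-> gdom F g p) /\
    (gdom F g p -> word_fn F g y \notin tp /\
       gindex F (word_fn F g y, true) = gindex F (gfn F g p)).
  by apply: filter_forall => g; exact: near_word_germ.
apply: filterS => y h; rewrite /theta /Theta [LHS]big_mkcond /=.
apply: eq_bigr => g _; have [h1 h2] := h g; case: (boolP (gdom F g p)) => [gp|/negP ngp].
  have [yt e] := h2 gp; rewrite asboolT; last by split; [exact/h1|exact: gdom_fat gp].
  by rewrite Dsym_germ // /gsymbol e.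
by rewrite asboolF // => -[/h1].
Qed.

Lemma theta_lim p : tadic_lim (side p) (theta F) = Theta^~ p.
Proof.
have cvgT : tadic_cvg (side p) (theta F) (Theta^~ p).
  elim=> [|N IH]; first exact: nearW.
  apply: filterS2 (near_theta N p) IH => y h1 h2 m.
  by rewrite ltnS leq_eqVlt => /predU1P[->//|]; exact: h2.
rewrite /tadic_lim; case: xgetP => [L _ /= cvgL|/(_ _ cvgT)//].
apply/funext => m; have [y [<-//]] := filter_ex (filterI (cvgL m.+1) (near_theta m p)).
Qed.

Lemma kneading_incrementE (i : 'I_k) m :
  kneading_increment i m = Theta m (cpt F i, true) - Theta m (cpt F i, false).
Proof.
rewrite /kneading_increment.
have := theta_lim (cpt F i, true); rewrite /side /= => ->.
by have := theta_lim (cpt F i, false); rewrite /side /= => ->.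
Qed.

Lemma fn_signE r : fn_sign F r = if inc F r then 1 else -1.
Proof. by []. Qed.

Lemma Theta0 p : Theta 0 p = delta_mx 0 (gsymbol p).
Proof.
rewrite /Theta (bigD1 (nil_tuple _)) //= big1 ?addr0 => [|g].
  by rewrite /word_sign big_nil scale1r.
by rewrite [g]tuple0 eqxx.
Qed.

Lemma ThetaS m p : Theta m.+1 p =
  \sum_(r < n | gmem F r p) fn_sign F r *: Theta m (gstep F r p).
Proof.
rewrite /Theta (@big_tuple_cons (symV F) _ _ (fun g => if gdom F g p then
  word_sign F g *: delta_mx 0 (gsymbol (gfn F g p)) else 0)).
rewrite [RHS]big_mkcond; apply: eq_bigr => r _ /=; case: ifP => m_rp /=.
  rewrite scaler_sumr; apply: eq_bigr => g _.
  by case: ifP => _; rewrite ?scaler0 // /word_sign big_cons scalerA.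
by rewrite big1.
Qed.

Lemma locally_constant_Theta m : locally_constant (Theta m).
Proof.
apply: locally_constant_sum => g.
apply: (locally_constant_word _ (f := fun p => word_sign F g *: delta_mx 0 (gsymbol p))).
by move=> p; apply: filterS (locally_constant_gindex F p) => y hy b; rewrite /gsymbol hy.
Qed.

Lemma gmem_min r : ~~ gmem F r (cpt F 0, false).
Proof.
by rewrite /gmem /below /= negb_and -leNgt cpt0_le // lo_turning.
Qed.

Lemma gmem_turning r x b : x \notin tp -> gmem F r (x, b) = (lo F r < x < hi F r).
Proof.
move=> xt; rewrite /gmem !below_germ -?leNgt; last 2 first.
- by apply/eqP => xhi; case/negP: xt; rewrite xhi hi_turning.
- by apply/eqP => xlo; case/negP: xt; rewrite xlo lo_turning.
congr (_ && _); rewrite le_eqVlt; case: eqP => // xhi.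
by case/negP: xt; rewrite xhi hi_turning.
Qed.

Lemma gindex_turning x b : x \notin tp -> gindex F (x, b) = gindex F (x, true).
Proof.
move=> xt; apply: eq_in_count => c ct; rewrite !below_germ //;
by apply/eqP => xc; case/negP: xt; rewrite xc.
Qed.

Lemma gindex_min : (0 < n)%N -> gindex F (cpt F 0, false) = 0%N.
Proof.
move=> n0; apply/eqP; rewrite -leqn0 leqNgt -has_count; apply/hasPn => c ct.
by rewrite /below /= -leNgt cpt0_le.
Qed.

Lemma Theta_decomposition m p : (0 < n)%N ->
  Theta m p = delta_mx 0 ord0 *+ (m == 0%N) +
    \sum_(i < k) \sum_(j < m.+1) kneading_increment i (m - j) *+ nhits i j p.
Proof.
move=> n0; apply/eqP; rewrite addrC -subr_eq; apply/eqP.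
(* To the left of all turning points theta equals P_0, while the decomposition needs a function that
   vanishes there. *)
pose phi m p := Theta m p - delta_mx 0 ord0 *+ (m == 0%N).
have jumpE m' x : jump phi m' x = Theta m' (x, true) - Theta m' (x, false).
  by rewrite /jump /phi opprB addrA subrK.
rewrite -/(phi m p) (@first_hit_decomposition _ _ F _ phi).
- apply: eq_bigr => i _; apply: eq_bigr => j _.
  by rewrite jumpE kneading_incrementE.
- move=> m'; apply: (locally_constant2 (fun a b : symV F => a - b)).
    exact: locally_constant_Theta.
  by move=> q; exact: nearW.
- case=> [|m']; rewrite /phi.
    have -> : ord0 = gsymbol (cpt F 0, false).
      by apply: val_inj; rewrite /= inordK gindex_min.
    by rewrite Theta0 mulr1n subrr.
  by rewrite ThetaS mulr0n subr0 big_pred0 // => r; apply/negbTE/gmem_min.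
- move=> x xt; rewrite jumpE !Theta0 /gsymbol [gindex F (x, false)]gindex_turning //.
  exact: subrr.
- move=> m' x xt; rewrite jumpE !ThetaS.
  rewrite (eq_bigl _ _ (fun r => gmem_turning r true xt)).
  rewrite (eq_bigl _ _ (fun r => gmem_turning r false xt)) -sumrB.
  (* A decreasing f_r exchanges the two germs and so reverses the jump, which the factor -1
     undoes. *)
  apply: eq_bigr => r _; rewrite jumpE fn_signE /gstep /=.
  by case: inc; rewrite ?scale1r // !scaleN1r opprK addrC.
Qed.

End Kneading.

Section InverseKneading.
Variables (R : realType) (n : nat) (F : system R n).
Hypothesis n_gt0 : (0 < n)%N.
Implicit Types (p : R * bool) (r : 'I_n) (x y c : R).
Local Notation tp := (turning_points F).
Local Notation k := (nturn F).

Lemma cpt_lt i j : (i < j)%N -> (j < k)%N -> cpt F i < cpt F j.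
Proof.
by move=> ij jk; apply: (sorted_ltn_nth lt_trans 0 (tp_sorted F)) => //;
  rewrite inE // (ltn_trans ij).
Qed.

Lemma cpt_le i j : (i <= j)%N -> (j < k)%N -> cpt F i <= cpt F j.
Proof.
rewrite leq_eqVlt => /predU1P[->//|ij] jk; exact/ltW/cpt_lt.
Qed.

Lemma gsymbol_cpt (i : 'I_k) : gsymbol F (cpt F i, true) = lift ord0 i.
Proof.
apply: val_inj; rewrite /= inordK ?gindex_le //= /bump /= add1n.
apply/eqP; rewrite eqn_leq; apply/andP; split.
  rewrite leqNgt; apply/negP => lt_i.
  have ik : (i.+1 < k)%N by rewrite (leq_trans lt_i) // -ltnS gindex_le.
  have := cpt_below (cpt F i, true) ik; rewrite lt_i /below /=.
  by rewrite leNgt cpt_lt.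
by have := cpt_below (cpt F i, true) (ltn_ord i); rewrite /below /= lexx => <-.
Qed.

Lemma gsymbol_min : gsymbol F (cpt F 0, false) = ord0.
Proof. by apply: val_inj; rewrite /= inordK gindex_min. Qed.

Lemma Pitv_sub_gmem p r :
  [set` Pitv (gsymbol F p)] `<=` [set` fn_dom F r] -> gmem F r p.
Proof.
move=> sub; apply: contrapT => /negP nm.
have := filter_ex (filterI (near_ngmem nm) (filterI (near_belows tp p)
  (locally_constant_gindex F p))).
move=> [y [yr [yt yi]]]; case/negP: yr.
have /sub : [set` Pitv (gsymbol F p)] y; last by rewrite /= in_itv.
rewrite /= Pitv_germ; first by rewrite /gsymbol yi.
by apply/negP => /yt[]; rewrite eqxx.
Qed.

(** The ends of I_r are turning points, so I_r contains P_i as soon as it contains the right germ of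
    c_i. Hence the sum in e_i runs over the letters that act on this germ. *)
Lemma Pitv_sub (i : 'I_k) r :
  `[< [set` Pitv (lift ord0 i)] `<=` [set` fn_dom F r] >] = gmem F r (cpt F i, true).
Proof.
apply/asboolP/idP => [|/andP[]]; first by rewrite -gsymbol_cpt => /Pitv_sub_gmem.
rewrite /below /= -ltNge => lo_i i_hi y.
have /turningP[j hiE] := hi_turning F r.
have ij : (i < j)%N.
  by rewrite ltnNge; apply/negP => /cpt_le/(_ (ltn_ord i)); rewrite -hiE leNgt i_hi.
have ik : (i.+1 < k)%N by exact: leq_ltn_trans (ltn_ord j).
rewrite /= in_itv /= /bump /= add1n ik !in_itv /= => /andP[y1 y2].
by rewrite (le_trans lo_i) // (le_trans y2) // hiE cpt_le.
Qed.

Lemma fpsC_sum (I : finType) (P : pred I) (f : I -> rat) :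
  fpsC (\sum_(i | P i) f i) = \sum_(i | P i) fpsC (f i).
Proof. by apply: fpsP => m; rewrite coefs_sum /= sumrMnl. Qed.

Lemma e_ser0 : e_ser (ord0 : 'I_k.+1) = 1.
Proof.
rewrite /e_ser big_pred0 => [|r]; last first.
  apply/asboolP; rewrite -gsymbol_min => /Pitv_sub_gmem.
  exact/negP/gmem_min.
by rewrite fpsC0 mulr0 subr0.
Qed.

Lemma e_serS (i : 'I_k) : e_ser (lift ord0 i) =
  1 - fpsX rat * \sum_(r < n | gmem F r (cpt F i, true)) fpsC (fn_sign F r).
Proof.
by rewrite /e_ser (eq_bigl _ _ (Pitv_sub i)) fpsC_sum.
Qed.

Definition Theta_ser p q : fps rat := Fps (fun m => Theta F m p 0 q).

Definition hit_ser p (i : 'I_k) : fps rat := Fps (fun m => (nhits i m p)%:R).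

Lemma Theta_serE p q : Theta_ser p q =
  (q == ord0)%:R + \sum_(i < k) hit_ser p i * kneading_matrix F i q.
Proof.
apply: fpsP => m; rewrite coefsD coefs_sum /Theta_ser [LHS]/=.
rewrite Theta_decomposition // mxE; congr (_ + _).
  case: m => [|m]; rewrite ?mulr0n ?mulr1n ?mxE //=; first by case: eqP.
  by case: eqP => _ //=; rewrite mul0rn.
rewrite summxE; apply: eq_bigr => i _; rewrite summxE coefs_mul.
apply: eq_bigr => j _; rewrite !mxE mulmxnE -[RHS]/(_ * kneading_increment i (m - j) 0 q).
by rewrite mulr_natl.
Qed.

Lemma Theta_serS p q : Theta_ser p q = (q == gsymbol F p)%:R +
  fpsX rat * \sum_(r < n | gmem F r p) fpsC (fn_sign F r) * Theta_ser (gstep F r p) q.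
Proof.
apply: fpsP => m; rewrite coefsD coefs_mulX /Theta_ser [LHS]/=.
case: m => [|m].
  by rewrite Theta0 mxE eqxx addr0 /=; case: eqP.
rewrite ThetaS summxE coefs_sum.
have -> : coefs ((q == gsymbol F p)%:R : fps rat) m.+1 = 0.
  by case: eqP => _ /=; rewrite ?mul0rn // mulr0n.
rewrite add0r; apply: eq_bigr => r _.
by rewrite mxE coefs_mulC.
Qed.

(* The rows express the symbols P_1, ..., P_(l+1), modulo P_0, as combinations
   of the kneading increments. *)
Definition kneading_inverse : 'M[fps rat]_k := \matrix_(i, i')
  (hit_ser (cpt F i, true) i' -
   fpsX rat * \sum_(r < n | gmem F r (cpt F i, true))
     fpsC (fn_sign F r) * hit_ser (gstep F r (cpt F i, true)) i').

(** By [Theta_serE] each A(p) N is theta(p) - P_0. The theta terms collapse to the symbol of the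
    germ by [Theta_serS], and the multiples of P_0 add up to -e_i P_0. *)
Lemma kneading_inverse_mul i q :
  (kneading_inverse *m kneading_matrix F) i q =
  (q == lift ord0 i)%:R - (q == ord0)%:R * e_ser (lift ord0 i).
Proof.
set p := (cpt F i, true); set dl : fps rat := (q == ord0)%:R.
have dec p' : \sum_(i' < k) hit_ser p' i' * kneading_matrix F i' q = Theta_ser p' q - dl.
  by rewrite Theta_serE addrC addKr.
transitivity (Theta_ser p q - dl - fpsX rat * \sum_(r < n | gmem F r p)
    fpsC (fn_sign F r) * (Theta_ser (gstep F r p) q - dl)).
  rewrite mxE; under [in RHS]eq_bigr do rewrite -dec.
  rewrite -dec [in RHS]big_distrr /= (eq_bigr (fun i' => hit_ser p i' * kneading_matrix F i' q -
    \sum_(r < n | gmem F r p) fpsX rat * (fpsC (fn_sign F r) *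
      (hit_ser (gstep F r p) i' * kneading_matrix F i' q)))) => [|i' _].
    rewrite sumrB; congr (_ - _); rewrite exchange_big /=; apply: eq_bigr => r _.
    by rewrite !big_distrr.
  rewrite [X in X * _ = _]mxE mulrBl; congr (_ - _).
  rewrite -mulrA big_distrl big_distrr /=; apply: eq_bigr => r _.
  by rewrite -mulrA.
rewrite {1}Theta_serS gsymbol_cpt e_serS -/p.
under [X in _ - _ * X = _]eq_bigr do rewrite mulrBr.
rewrite sumrB -big_distrl /=.
set A := \sum_(r < n | _) _ * _; set B := \sum_(r < n | _) _.
by ring.
Qed.

(** Deleting column j in U N = [-e | I] shows that det U times the minor is (-1)^j e_j, which the
    prefactor of the kneading determinant cancels; e_0 = 1 makes j = 0 fit the same formula. *)
Lemma kneading_det_inverse (j : 'I_k.+1) :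
  kneading_det j * \det kneading_inverse = 1.
Proof.
have e_unit := e_ser_unit j.
have := @det_col'_echelon _ _ (fun i => e_ser (lift ord0 i)) _ j kneading_inverse_mul.
have -> : (if unlift ord0 j is Some i then e_ser (lift ord0 i) else 1) = e_ser j.
  by case: unliftP => [i ->//|->]; rewrite e_ser0.
have -> : col' j (kneading_inverse *m kneading_matrix F) =
    kneading_inverse *m col' j (kneading_matrix F) :> 'M[fps rat]_k.
  apply/matrixP => a b; rewrite [LHS]mxE [LHS]mxE [RHS]mxE.
  by apply: eq_bigr => c _; rewrite [X in _ = _ * X]mxE.
rewrite det_mulmx mulrC => detE; rewrite /kneading_det -[LHS]mulrA.
transitivity ((-1) ^+ j / e_ser j * ((-1) ^+ j * e_ser j)).
  by congr (_ * _); exact: detE.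
by rewrite mulrACA -expr2 -exprM mulnC exprM sqrrN expr1n expr1n mul1r mulVr.
Qed.

End InverseKneading.

(** * Endpoints of domains *)

Lemma big_tuple_cat (V : nmodType) (I : finType) m m' (f : seq I -> V) :
  \sum_(g : (m + m').-tuple I) f g =
  \sum_(g : m.-tuple I) \sum_(g' : m'.-tuple I) f (g ++ g').
Proof.
elim: m f => [|m IH] f.
  rewrite add0n [RHS](bigD1 (nil_tuple _)) //= [X in _ + X]big1 ?addr0 // => g.
  by rewrite [g]tuple0 eqxx.
rewrite addSn big_tuple_cons (@big_tuple_cons V _ m
  (fun g => \sum_(g' : m'.-tuple I) f (g ++ g'))).
by apply: eq_bigr => i _; rewrite (IH (fun g => f (i :: g))).
Qed.

Section Counting.
Variables (R : realType) (n : nat) (F : system R n).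
Implicit Types (p : R * bool) (r : 'I_n) (g h : seq 'I_n) (x y c : R).
Local Notation tp := (turning_points F).
Local Notation k := (nturn F).

Lemma Dom_is_interval g : is_interval (Dom F g).
Proof.
elim: g => [//|r g IH] x y /= [xI xD] [yI yD] z /andP[xz zy].
have zI : z \in fn_dom F r.
  move: xI yI; rewrite !in_itv /= => /andP[x1 _] /andP[_ y2].
  by rewrite (le_trans x1 xz) (le_trans zy y2).
split=> //; have [<-//|xz'] := eqVneq x z; have [->//|zy'] := eqVneq z y.
have {xz'}xz : x < z by rewrite lt_neqAle xz'.
have {zy'}zy : z < y by rewrite lt_neqAle zy'.
have [h|h] := fn_monotone F r.
  by apply: (IH _ _ xD yD); rewrite !ltW // h.
by apply: (IH _ _ yD xD); rewrite !ltW // h.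
Qed.

Lemma fat_bounds g : g != [::] -> fat F g -> exists u v,
  [/\ u < v, forall y, u < y < v -> Dom F g y & forall y, Dom F g y -> u <= y <= v].
Proof.
case: g => [//|r g] _ [x0 /nbhs_normP[e /= e0 he]].
set D := Dom F (r :: g) in he.
have lbD : lbound D (lo F r) by move=> y [] /=; rewrite in_itv /= => /andP[].
have ubD : ubound D (hi F r) by move=> y [] /=; rewrite in_itv /= => /andP[].
have D1 : D (x0 - e / 2).
  by apply: he => /=; rewrite opprB addrC subrK gtr0_norm; lra.
have D2 : D (x0 + e / 2).
  by apply: he => /=; rewrite opprD addrA subrr sub0r normrN gtr0_norm; lra.
have hlb : has_lbound D by exists (lo F r).
have hub : has_ubound D by exists (hi F r).
have D0 : D !=set0 by exists (x0 - e / 2).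
exists (inf D), (sup D); split.
- apply: (@le_lt_trans _ _ (x0 - e / 2)); first exact: ge_inf.
  apply: (@lt_le_trans _ _ (x0 + e / 2)); first by lra.
  exact: ub_le_sup.
- move=> y /andP[/(inf_lt D0)[a Da ay] /(sup_gt D0)[b Db yb]].
  by apply: (Dom_is_interval Da Db); rewrite !ltW.
- by move=> y Dy; rewrite ge_inf // ub_le_sup.
Qed.

(** The germs in a fat domain run from the right germ of u to the left germ of v, whether or not u
    and v belong to the domain. *)
Lemma gdom_bounds g : g != [::] -> fat F g -> exists u v,
  [/\ u < v, forall p, gdom F g p = below u p && ~~ below v p,
   forall y, u < y < v -> Dom F g y & forall y, Dom F g y -> u <= y <= v].
Proof.
move=> g0 gf; have [u [v [uv inD Din]]] := fat_bounds g0 gf.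
exists u, v; split=> // p.
have := filter_ex (filterI (near_word_germ F g p)
  (filterI (near_below u p) (near_below v p))).
move=> [y [[gE _] [[yu <-] [yv <-]]]]; apply/idP/idP.
  move=> /gE/Din/andP[uy yv']; rewrite -leNgt yv' andbT.
  by rewrite lt_neqAle eq_sym yu.
rewrite -leNgt => /andP[uy yv']; apply/gE/inD.
by rewrite uy lt_neqAle yv.
Qed.

(** Left and right ends are kept apart because [crossed] needs predicates with at most one solution,
    whereas [end_point] has two. *)
Definition left_end g x := gdom F g (x, true) && ~~ gdom F g (x, false).
Definition right_end g x := ~~ gdom F g (x, true) && gdom F g (x, false).
Definition end_point g x := gdom F g (x, true) (+) gdom F g (x, false).

Lemma end_pointE g x : (end_point g x = left_end g x + right_end g x :> nat)%N.
Proof.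
by rewrite /end_point /left_end /right_end; do 2 case: gdom.
Qed.

Lemma end_point_fat g x : end_point g x -> fat F g.
Proof.
rewrite /end_point; have [h _|_] := boolP (gdom F g (x, true)); first exact: gdom_fat h.
by rewrite addFb; exact: gdom_fat.
Qed.

Lemma end_point_nil x : end_point [::] x = false. Proof. by []. Qed.

Lemma ends_bounds g : g != [::] -> fat F g -> exists u v,
  (forall x, left_end g x = (x == u)) /\ (forall x, right_end g x = (x == v)).
Proof.
move=> g0 gf; have [u [v [uv gE _ _]]] := gdom_bounds g0 gf.
exists u, v; split=> x; rewrite /left_end /right_end !gE /below /=.
  have [xu|xu|->] := ltgtP x u; rewrite ?lexx ?ltxx ?andbF //=.
    by rewrite -ltNge -leNgt; case: ltgtP => //= xv; rewrite ?ltW.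
  by rewrite -ltNge uv.
have [xv|xv|->] := ltgtP x v; rewrite ?lexx ?ltxx ?andbF ?andbT //=.
by case: ltgtP.
Qed.

Lemma left_end_inj g x y : left_end g x -> left_end g y -> x = y.
Proof.
have [->|g0] := eqVneq g [::]; first by [].
move=> lx ly; have gf : fat F g by case/andP: (lx) => /gdom_fat.
by have [u [v [lE _]]] := ends_bounds g0 gf; move: lx ly; rewrite !lE => /eqP-> /eqP->.
Qed.

Lemma right_end_inj g x y : right_end g x -> right_end g y -> x = y.
Proof.
have [->|g0] := eqVneq g [::]; first by [].
move=> lx ly; have gf : fat F g by case/andP: (lx) => _ /gdom_fat.
by have [u [v [_ lE]]] := ends_bounds g0 gf; move: lx ly; rewrite !lE => /eqP-> /eqP->.
Qed.

Lemma boundary_end g c : fat F g -> boundary (Dom F g) c <-> end_point g c.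
Proof.
move=> gf; split=> [[clc nint]|ec]; last first.
  split; last first.
    move=> intc; move: ec; rewrite /end_point.
    by rewrite (interior_gdom true intc) (interior_gdom false intc).
  have [b gb] : exists b, gdom F g (c, b).
    by move: ec; rewrite /end_point; case: (boolP (gdom F g (c, true))) => h;
      [exists true|exists false].
  move=> B /nbhs_normP[e e0 hB].
  have : \forall y \near side (c, b), B y.
    by apply/sideP; exists e => //= y _ _ d; apply: hB; rewrite /= distrC.
  move=> nB; have [y [By [[_ h] _]]] := filter_ex (filterI nB (near_word_germ F g (c, b))).
  by exists y; split=> //; exact: h.
have [g0|g0] := eqVneq g [::].
  by case: nint; rewrite g0; apply: filterS (@filterT _ (nbhs c) _).
have [u [v [uv gE inD Din]]] := gdom_bounds g0 gf.
have uc : u <= c.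
  rewrite leNgt; apply/negP => cu; have [] := clc [set y | y < u].
    exact: lt_nbhsl.
  by move=> y [/Din/andP[uy _] /=]; rewrite ltNge uy.
have cv : c <= v.
  rewrite leNgt; apply/negP => vc; have [] := clc [set y | v < y].
    exact: lt_nbhsr.
  by move=> y [/Din/andP[_ yv] /=]; rewrite ltNge yv.
rewrite /end_point !gE /below /= uc /= -ltNge.
have [->|cu] := eqVneq c u; first by rewrite ltxx uv.
have [->|cv'] := eqVneq c v; first by rewrite !ltxx uv.
case: nint; have ltuc : u < c by rewrite lt_neqAle eq_sym cu.
have ltcv : c < v by rewrite lt_neqAle cv'.
apply: filterS2 (lt_nbhsr ltuc) (lt_nbhsl ltcv) => y uy yv.
by apply: inD; rewrite uy.
Qed.

Lemma ell'E c m : ell' F c m = (\sum_(g : m.-tuple 'I_n) end_point g c)%N.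
Proof.
rewrite /ell' -sum1_card big_mkcond /=; apply: eq_bigr => g _.
rewrite unfold_in /=; case: asboolP => [[gf /(boundary_end _ gf) ->//]|h].
case: (boolP (end_point g c)) => // ec; case: h.
have gf := end_point_fat ec; split=> //; exact/boundary_end.
Qed.

Lemma ellE m : ell F m = (\sum_(g : m.-tuple 'I_n) `[< fat F g >])%N.
Proof.
rewrite /ell -sum1_card big_mkcond /=; apply: eq_bigr => g _.
by rewrite unfold_in /=; case: asbool.
Qed.

Lemma fat_gdomP g : fat F g <-> exists p, gdom F g p.
Proof.
split=> [[x /(interior_gdom true) h]|[p]]; first by exists (x, true).
exact: gdom_fat.
Qed.

Lemma gdom_cat g g' p : gdom F (g ++ g') p = gdom F g p && gdom F g' (gfn F g p).
Proof. by elim: g p => [|r g IH] p //=; rewrite IH andbA. Qed.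

(** A word has a fat domain exactly when it acts on some germ, and a germ on which g g' acts
    provides one for g and, through its image, one for g'. *)
Lemma ell_submul m m' : (ell F (m + m') <= ell F m * ell F m')%N.
Proof.
rewrite !ellE (@big_tuple_cat nat _ _ _ (fun g => nat_of_bool `[< fat F g >])).
rewrite big_distrl /=; apply: leq_sum => g _.
rewrite big_distrr /=; apply: leq_sum => g' _.
case: asboolP => // /fat_gdomP[p]; rewrite gdom_cat => /andP[gp g'p].
rewrite !asboolT //; first by apply/fat_gdomP; exists (gfn F g p).
by apply/fat_gdomP; exists p.
Qed.

Lemma ell_le m : (ell F m <= n ^ m)%N.
Proof. by rewrite -[n in (n ^ m)%N]card_ord -card_tuple max_card. Qed.

Lemma ell'_le c m : (ell' F c m <= n ^ m)%N.
Proof. by rewrite -[n in (n ^ m)%N]card_ord -card_tuple max_card. Qed.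

Lemma nhits_le (i : 'I_k) m p : (nhits i m p <= ell F m)%N.
Proof.
rewrite ellE; apply: leq_sum => h _; rewrite /crossed.
case: asboolP => // -[x [_ /(@hits_gdom _ _ _ i h x true) hx]].
by rewrite asboolT //; exact: gdom_fat hx.
Qed.

Definition ends_below m p : nat := \sum_(g : m.-tuple 'I_n)
  (crossed (left_end g) p + crossed (right_end g) p)%N.

Lemma locally_constant_ends_below m : locally_constant (ends_below m).
Proof.
apply: (@locally_constant_sum R nat) => g.
apply: (locally_constant2 (fun a b : bool => (a + b)%N)).
  exact/locally_constant_crossed/left_end_inj.
exact/locally_constant_crossed/right_end_inj.
Qed.

Lemma ends_below_jump m x :
  ends_below m (x, true) = (ell' F x m + ends_below m (x, false))%N.
Proof.
rewrite ell'E /ends_below -big_split /=; apply: eq_bigr => g _.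
rewrite !crossed_jump; [|exact: right_end_inj|exact: left_end_inj].
by rewrite !asboolb end_pointE addnACA.
Qed.

Lemma end_ge_min g x : g != [::] -> left_end g x || right_end g x -> cpt F 0 <= x.
Proof.
case: g => [//|r g] _; rewrite /left_end /right_end /= => h.
have : gmem F r (x, true) || gmem F r (x, false).
  by case: gmem h => //=; case: gmem.
move=> /orP[] /andP[]; rewrite /below /=; [move=> h1 _|move=> /ltW h1 _];
  exact: le_trans (cpt0_le (lo_turning F r)) h1.
Qed.

Lemma end_le_max g x : g != [::] -> left_end g x || right_end g x -> x <= cpt F k.-1.
Proof.
case: g => [//|r g] _; rewrite /left_end /right_end /= => h.
have : gmem F r (x, true) || gmem F r (x, false).
  by case: gmem h => //=; case: gmem.
move=> /orP[] /andP[_]; rewrite /below /= -?ltNge -?leNgt; [move=> /ltW h1|move=> h1];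
  exact: le_trans h1 (cpt_last_ge (hi_turning F r)).
Qed.

Lemma ends_below_min m : ends_below m (cpt F 0, false) = 0%N.
Proof.
apply: big1 => g _; have [->|g0] := eqVneq (g : seq 'I_n) [::].
  rewrite /crossed !asboolF //; by case=> x [].
rewrite /crossed !asboolF // => -[x [/= xp xe]];
have : cpt F 0 <= x by apply: (end_ge_min g0); rewrite xe ?orbT.
  by rewrite leNgt; rewrite /below /= in xp; rewrite xp.
by rewrite leNgt; rewrite /below /= in xp; rewrite xp.
Qed.

Lemma ends_below_max m : ends_below m.+1 (cpt F k.-1, true) = (2 * ell F m.+1)%N.
Proof.
rewrite ellE /ends_below big_distrr /=; apply: eq_bigr => g _.
have g0 : (g : seq 'I_n) != [::] by rewrite -size_eq0 size_tuple.
case: asboolP => [gf|ngf].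
  have [u [v [lE rE]]] := ends_bounds g0 gf.
  rewrite /crossed !asboolT //; [exists v|exists u].
    by split; [apply: (end_le_max g0); rewrite rE eqxx orbT|rewrite rE].
  by split; [apply: (end_le_max g0); rewrite lE eqxx|rewrite lE].
rewrite /crossed !asboolF // => -[x [_]]; move=> h; case: ngf.
  by case/andP: h => _; exact: gdom_fat.
by case/andP: h => h _; exact: gdom_fat h.
Qed.

Lemma ell_first_hits m : (0 < n)%N -> (2 * ell F m.+1)%:R =
  \sum_(i < k) \sum_(j < m.+2)
    (nhits i j (cpt F k.-1, true))%:R * (ell' F (cpt F i) (m.+1 - j))%:R :> rat.
Proof.
move=> n0; pose phi m' p : rat := (ends_below m' p)%:R.
have jumpE m' x : jump phi m' x = (ell' F x m')%:R.
  by rewrite /jump /phi ends_below_jump natrD addrK.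
rewrite -ends_below_max -/(phi m.+1 (cpt F k.-1, true)).
rewrite (@first_hit_decomposition _ _ F _ phi).
- by apply: eq_bigr => i _; apply: eq_bigr => j _; rewrite jumpE mulr_natl.
- move=> m' p; apply: filterS (locally_constant_ends_below m' p) => y hy b.
  by rewrite /phi hy.
- by move=> m'; rewrite /phi ends_below_min.
- move=> x _; rewrite jumpE ell'E big1 // => g _.
  by rewrite [g]tuple0 end_point_nil.
- move=> m' x xt; rewrite jumpE ell'E.
  rewrite (@big_tuple_cons nat _ _ (fun g => nat_of_bool (end_point g x))) natr_sum.
  rewrite [RHS]big_mkcond; apply: eq_bigr => r _; rewrite jumpE ell'E.
  case: ifP => xr; last first.
    by rewrite big1 // => g _; rewrite /end_point /= !gmem_turning // xr.
  (* Both germs of a non-turning x enter I_r, so x is an end for r g exactly when f_r(x) is one for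
     g; exchanging the sides does not affect the symmetric [end_point]. *)
  congr (_%:R); apply: eq_bigr => g _.
  rewrite /end_point /= !gmem_turning // xr /gstep /=.
  by case: inc; rewrite //= addbC.
Qed.

Lemma gfn_germs g c : exists x b, gfn F g (c, true) = (x, b) /\
  gfn F g (c, false) = (x, ~~ b).
Proof.
suff h c1 b : exists x b', gfn F g (c1, b) = (x, b') /\ gfn F g (c1, ~~ b) = (x, ~~ b').
  exact: h c true.
elim: g c1 b => [|r g IH] c1 b /=; first by exists c1, b.
rewrite /gstep /=; have -> : (~~ b == inc F r) = ~~ (b == inc F r).
  by case: b; case: inc.
exact: IH.
Qed.

Lemma norm_word_sign g : `|word_sign F g| = 1.
Proof.
rewrite /word_sign normr_prod big1 // => r _.
by rewrite fn_signE; case: inc; rewrite ?normr1 ?normrN1.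
Qed.

Lemma end_point_rcons g r c : gdom F g (c, true) -> gdom F g (c, false) ->
  end_point (rcons g r) c =
  gmem F r (gfn F g (c, true)) (+) gmem F r (gfn F g (c, false)).
Proof.
by move=> h1 h2; rewrite /end_point -cats1 !gdom_cat h1 h2 /= !andbT.
Qed.

Lemma gmem_endpoint r x : x = lo F r \/ x = hi F r ->
  gmem F r (x, true) (+) gmem F r (x, false).
Proof.
have := lo_lt_hi F r; rewrite /gmem /below /= => lt [->|->].
  by rewrite lexx ltxx -ltNge lt.
by rewrite lexx ltxx lt andbF.
Qed.

(** Word by word. If g acts on only one germ of c, it contributes at most 1 and is counted by [ell']
    at m. If it acts on both, the images are the two germs of one point x, and the terms can differ
    only when x is a turning point, hence an end of some I_r. Then c is an end of the domain of g r,
    which is counted at m + 1. *)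
Lemma kneading_increment_le (i : 'I_k) m q :
  `|kneading_increment i m 0 q| <=
  (ell' F (cpt F i) m + ell' F (cpt F i) m.+1)%:R.
Proof.
set c := cpt F i; rewrite kneading_incrementE -/c mxE mxE /Theta !summxE -sumrB.
rewrite (le_trans (ler_norm_sum _ _ _)) // !ell'E.
rewrite (@big_tuple_rcons nat _ _ (fun g => nat_of_bool (end_point g c))).
rewrite -big_split /= natr_sum; apply: ler_sum => g _.
have le01 (a b : bool) : `|a%:R - b%:R| <= 1 :> rat.
  by case: a; case: b; rewrite ?subrr ?subr0 ?sub0r ?normrN ?normr0 ?normr1.
have le1 (p : R * bool) :
    `|(word_sign F g *: delta_mx 0 (gsymbol F p) : symV F) 0 q| <= 1.
  by rewrite !mxE normrM norm_word_sign mul1r; case: (_ && _); rewrite ?normr1 ?normr0.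
case: ifP => h1; case: ifP => h2; last first.
- by rewrite mxE subrr normr0 ler0n.
- rewrite [X in X - _]mxE sub0r normrN (le_trans (le1 _)) //.
  by rewrite (ler_nat _ 1) /end_point h1 h2.
- rewrite [X in _ - X]mxE subr0 (le_trans (le1 _)) //.
  by rewrite (ler_nat _ 1) /end_point h1 h2.
have [x [b [e1 e2]]] := gfn_germs g c; rewrite e1 e2.
have [xt|xt] := boolP (x \in tp); last first.
  rewrite /gsymbol (gindex_turning b xt) (gindex_turning (~~ b) xt) subrr normr0.
  exact: ler0n.
have [r xr] := turning_endpoint xt.
apply: (@le_trans _ _ 1).
  by rewrite !mxE -mulrBr normrM norm_word_sign mul1r le01.
rewrite (ler_nat _ 1) (bigD1 r) //= end_point_rcons // e1 e2.
have := gmem_endpoint xr; case: b {e1 e2} => /=; last rewrite addbC => ->.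
  by move=> ->; rewrite addnCA.
by rewrite addnCA.
Qed.

End Counting.

(** * Conclusion *)

Lemma mulr1_inj_l (K : comPzRingType) (a b c : K) : a * c = 1 -> b * c = 1 -> a = b.
Proof. by move=> ac bc; rewrite -[a]mulr1 -bc mulrCA ac mulr1. Qed.

(** * Rational series regarded as complex ones *)

Section RatCoefs.
Variables (R : realType).
Local Notation C := (cplx R).

Definition fps_ratr (a : fps rat) : fps C := Fps (fun m => ratr (coefs a m)).

Fact fps_ratr_zmod_morphism : zmod_morphism fps_ratr.
Proof. by move=> a b; apply: fpsP => m /=; rewrite rmorphB. Qed.

Fact fps_ratr_monoid_morphism : monoid_morphism fps_ratr.
Proof.
split=> [|a b]; apply: fpsP => m.
  by rewrite /= rmorphMn /= rmorph1.
rewrite coefs_mul [LHS]/= rmorph_sum; apply: eq_bigr => i _.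
by rewrite rmorphM.
Qed.

HB.instance Definition _ :=
  GRing.isZmodMorphism.Build (fps rat) (fps C) fps_ratr fps_ratr_zmod_morphism.
HB.instance Definition _ :=
  GRing.isMonoidMorphism.Build (fps rat) (fps C) fps_ratr fps_ratr_monoid_morphism.

Lemma fps_ratrC x : fps_ratr (fpsC x) = fpsC (ratr x).
Proof. by apply: fpsP => m /=; rewrite rmorphMn. Qed.

Lemma fps_ratrX : fps_ratr (fpsX rat) = fpsX C.
Proof. by apply: fpsP => m /=; rewrite rmorph_nat. Qed.

Lemma modulus_ratr (x : rat) : modulus (ratr x : C) = ratr `|x|.
Proof.
have -> : ratr x = of_real (ratr x) :> C.
  by rewrite -(fmorph_eq_rat (real_complex R \o ratr) x).
by rewrite modulus_of_real ratr_norm.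
Qed.

Variable sg : R.
Hypothesis sg_ge0 : 0 <= sg.

Definition rconv (a : fps rat) := sconv sg (fps_ratr a).

Lemma rconv_bound (a : fps rat) (u : nat -> nat) :
  (forall m, `|coefs a m| <= (u m)%:R) ->
  (forall r : R, sg < r -> exists M : R, forall m, (u m)%:R <= M * r ^+ m) -> rconv a.
Proof.
move=> au hu r /hu[M hM]; exists M => m; apply: le_trans (hM m).
by rewrite /= modulus_ratr -(ratr_nat R) ler_rat.
Qed.

Lemma rconvD a b : rconv a -> rconv b -> rconv (a + b).
Proof. by rewrite /rconv rmorphD; exact: sconvD. Qed.

Lemma rconvN a : rconv a -> rconv (- a).
Proof. by rewrite /rconv rmorphN; exact: sconvN. Qed.

Lemma rconvM a b : rconv a -> rconv b -> rconv (a * b).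
Proof. by rewrite /rconv rmorphM; exact: sconvM. Qed.

Lemma rconvC x : rconv (fpsC x).
Proof. by rewrite /rconv fps_ratrC; exact: sconvC. Qed.

Lemma rconvX : rconv (fpsX rat).
Proof. by rewrite /rconv fps_ratrX; exact: sconvX. Qed.

Lemma rconv0 : rconv 0. Proof. exact: rconvC. Qed.

Lemma rconv1 : rconv 1. Proof. exact: rconvC. Qed.

Lemma rconv_sum (I : Type) (r : seq I) (P : pred I) (f : I -> fps rat) :
  (forall i, P i -> rconv (f i)) -> rconv (\sum_(i <- r | P i) f i).
Proof. by move=> h; apply: big_ind => //; [exact: rconv0|exact: rconvD]. Qed.

Lemma rconv_sign b : rconv ((-1) ^+ b).
Proof.
elim: b => [|b IH]; first exact: rconv1.
by rewrite exprS mulN1r; exact: rconvN.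
Qed.

Lemma rconv_det k (M : 'M[fps rat]_k) : (forall i j, rconv (M i j)) -> rconv (\det M).
Proof.
move=> h; apply: rconv_sum => p _; apply: rconvM; first exact: rconv_sign.
by apply: big_ind => //; [exact: rconv1|exact: rconvM].
Qed.

Lemma rconv_shift a : rconv a -> rconv (fps_shift a).
Proof. exact: (@sconv_shift R sg (fps_ratr a)). Qed.

End RatCoefs.

(** * Discs of convergence of the series attached to the system *)

Section MainFacts.
Variables (R : realType) (n : nat) (F : system R n).
Hypotheses (n_gt0 : (0 < n)%N) (lt_s0_s : s0 F < s F).
Local Notation k := (nturn F).

Lemma s0_ge0 : 0 <= s0 F.
Proof. exact: bigmax_ge_id. Qed.

Lemma s_gt0 : 0 < s F. Proof. exact: le_lt_trans s0_ge0 lt_s0_s. Qed.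

Lemma ell'_bound (i : 'I_k) (r : R) : s0 F < r ->
  exists M : R, forall m, (ell' F (cpt F i) m)%:R <= M * r ^+ m.
Proof.
move=> s0r; apply: (growth_bound n_gt0); first exact: ell'_le.
apply: le_lt_trans s0r.
apply: (@order.Order.TotalTheory.le_bigmax_seq _ R _ (turning_points F) 0 (cpt F i)
  xpredT (fun c => growth R (ell' F c))) => //.
by apply/turningP; exists i.
Qed.

Lemma ell_bound (r : R) : s F < r -> exists M : R, forall m, (ell F m)%:R <= M * r ^+ m.
Proof. by move=> sr; apply: (growth_bound n_gt0) => //; exact: ell_le. Qed.

Lemma rconv_kneading_matrix i q : rconv (s0 F) (kneading_matrix F i q).
Proof.
rewrite mxE; apply: (rconv_bound (u := fun m =>
  (ell' F (cpt F i) m + ell' F (cpt F i) m.+1)%N)) => [m|r s0r].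
  exact: kneading_increment_le.
have [M hM] := ell'_bound i s0r; exists (M + M * r) => m.
by rewrite natrD mulrDl lerD // -mulrA -exprS.
Qed.

Lemma rconv_hit_ser p (i : 'I_k) : rconv (s F) (hit_ser p i).
Proof.
apply: (rconv_bound (u := ell F)) => [m|]; last exact: ell_bound.
by rewrite /= normr_nat ler_nat nhits_le.
Qed.

Lemma rconv_det_inverse : rconv (s F) (\det (kneading_inverse F)).
Proof.
have sge0 := ltW s_gt0; apply: rconv_det => // i j; rewrite mxE.
apply: rconvD; first exact: rconv_hit_ser.
apply/rconvN/(rconvM sge0); first exact: rconvX.
apply: rconv_sum => // r _; apply: (rconvM sge0); first exact: rconvC.
exact: rconv_hit_ser.
Qed.

Local Notation D := (kneading_det (ord0 : 'I_k.+1)).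

Lemma kneading_det_indep (j : 'I_k.+1) : kneading_det j = D.
Proof.
have hj := kneading_det_inverse n_gt0 j; have h0 := kneading_det_inverse n_gt0 (ord0 : 'I_k.+1).
exact: mulr1_inj_l hj h0.
Qed.

Local Notation N0 := (col' ord0 (kneading_matrix F) : 'M[fps rat]_k).

(** Column 0 is the right one to delete for convergence: as e_0 = 1, no division occurs and D
    inherits the disc of the entries of N. *)
Lemma kneading_detE : D = \det N0.
Proof. by rewrite /kneading_det e_ser0 // expr0 divr1 mul1r. Qed.

Lemma rconv_D : rconv (s0 F) D.
Proof.
rewrite kneading_detE; apply: (rconv_det s0_ge0) => i j; rewrite mxE.
exact: rconv_kneading_matrix.
Qed.

(** Multiplication by D turns the entries of U into cofactors of N, which converge on the larger
    disc. *)
Lemma kneading_inverse_adj i j :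
  D * kneading_inverse F i j = (\adj N0) i j.
Proof.
have UN : kneading_inverse F *m N0 = 1%:M.
  apply/matrixP => a b; have := kneading_inverse_mul n_gt0 a (lift ord0 b).
  rewrite mxE => h; rewrite mxE; under eq_bigr do rewrite [X in _ * X]mxE.
  rewrite h (inj_eq lift_inj) [lift _ _ == ord0]eq_sym (negbTE (neq_lift _ _)).
  by rewrite mul0r subr0 mxE eq_sym.
have := mulmx1C UN => NU.
have : \adj N0 *m (N0 *m kneading_inverse F) = \adj N0 by rewrite NU mulmx1.
rewrite mulmxA mul_adj_mx mul_scalar_mx => <-.
by rewrite [RHS]mxE kneading_detE.
Qed.

Lemma rconv_adj i j : rconv (s0 F) ((\adj N0) i j).
Proof.
rewrite mxE; apply: (rconvM s0_ge0); first exact: (rconv_sign s0_ge0).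
apply: (rconv_det s0_ge0) => a b; rewrite mxE mxE mxE.
exact: rconv_kneading_matrix.
Qed.

Definition ell_ser : fps rat := Fps (fun m => (ell F m.+1)%:R).
Definition ell'_ser (i : 'I_k) : fps rat := Fps (fun m => (ell' F (cpt F i) m)%:R).

Lemma nturn_gt0 : (0 < k)%N.
Proof.
have : lo F (Ordinal n_gt0) \in turning_points F by exact: lo_turning.
by rewrite /nturn; case: turning_points.
Qed.

Lemma ell_ser_first_hits : fpsX rat * (fpsC 2 * ell_ser) =
  \sum_(i < k) hit_ser (cpt F k.-1, true) i * ell'_ser i.
Proof.
apply: fpsP => m; rewrite coefs_mulX coefs_sum.
case: m => [|m].
  rewrite big1 // => i _; rewrite coefs_mul big_ord1 /= ell'E big1 ?mulr0 // => g _.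
  by rewrite (tuple0 g).
rewrite coefs_mulC -natrM ell_first_hits //.
Qed.

Lemma rconv_ell_det : rconv (s0 F) (ell_ser * D).
Proof.
have kk : (k.-1 < k)%N by rewrite prednK // nturn_gt0.
(* No I_r reaches beyond the last turning point, so the correction sum in this row of
   [kneading_inverse] is empty. *)
have hE i : hit_ser (cpt F k.-1, true) i = kneading_inverse F (Ordinal kk) i.
  rewrite mxE big_pred0 ?mulr0 ?subr0 // => r.
  by rewrite /gmem /below /= [hi _ _ <= _]cpt_last_ge ?hi_turning // andbF.
have conv : rconv (s0 F) (fpsX rat * (fpsC 2 * ell_ser) * D).
  rewrite ell_ser_first_hits big_distrl /=; apply: (rconv_sum s0_ge0) => i _.
  rewrite hE mulrAC [_ * D]mulrC kneading_inverse_adj.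
  apply: (rconvM s0_ge0); first exact: rconv_adj.
  apply: (rconv_bound (u := ell' F (cpt F i))) => [m|]; last exact: ell'_bound.
  by rewrite /= normr_nat.
(* Division by 2t is a scaling and a shift of the coefficients, so it keeps the disc of
   convergence. *)
have -> : ell_ser * D = fpsC 2^-1 * fps_shift (fpsX rat * (fpsC 2 * ell_ser) * D).
  rewrite -[X in fps_shift X]mulrA fps_shiftMX; apply: fpsP => m.
  by rewrite coefs_mulC -mulrA coefs_mulC mulrA mulVf // mul1r.
apply: (rconvM s0_ge0); first exact: (rconvC s0_ge0).
exact: rconv_shift.
Qed.

Lemma rconv_ell : rconv (s F) ell_ser.
Proof.
apply: (rconv_bound (u := fun m => ell F m.+1)) => [m|r sr]; first by rewrite /= normr_nat.
have [M hM] := ell_bound sr; exists (M * r) => m.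
by rewrite -mulrA -exprS.
Qed.

Lemma ell_ge m : s F ^+ m.+1 <= (ell F m.+1)%:R.
Proof.
apply: (growth_submul n_gt0) => //; [exact: ell_le|exact: ell_submul|exact: s_gt0].
Qed.

End MainFacts.

Lemma coefs0_neq0 (K : fieldType) (a b : fps K) : a * b = 1 -> coefs a 0%N != 0.
Proof.
move=> /(congr1 (fun c => coefs c 0%N)); rewrite /= big_ord1 subnn mulr1n => ab.
by apply/eqP => a0; move/eqP: ab; rewrite a0 mul0r eq_sym oner_eq0.
Qed.

(** The inverse of 0 in the extended reals is +oo, in agreement with the reading of 1/s_0 for s_0 =
    0; both sides are then the whole plane. *)
Lemma disc_indisc (R : realType) (x : R) (z : cplx R) : 0 <= x ->
  disc (x%:E^-1)%E z = indisc x z.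
Proof.
move=> x0; rewrite /disc /indisc /= inver; case: eqP => [->|/eqP xn0].
  by rewrite mulr0 ltr01 ltry.
have {xn0}x_gt0 : 0 < x by rewrite lt_neqAle eq_sym xn0.
by rewrite lte_fin -[x^-1]mul1r ltr_pdivlMr.
Qed.

Theorem theorem4p8 (R : realType) (n : nat) (F : system R n) :
  (0 < n)%N -> s0 F < s F ->
  (exists L : cplx R -> cplx R,
    [/\ (forall t, disc (s F)^-1%:E t ->
           cpseries (fun m => (ell F m.+1)%:R) t @ \oo --> L t),
        meromorphic_on (disc ((s0 F)%:E^-1)%E) L &
        pole L (of_real (s F)^-1)]) /\
  (forall j : 'I_(nturn F).+1,
    let D := cpseries (fun m => ratr (coefs (kneading_det j) m)) in
    [/\ (forall t, disc ((s0 F)%:E^-1)%E t -> cvgn (D t)),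
        limn (D (of_real (s F)^-1)) = 0 &
        (forall t, disc (s F)^-1%:E t -> limn (D t) <> 0)]).
Proof.
move=> n0 ls; have s0_0 := s0_ge0 F; have s_0 := s_gt0 ls.
pose D := fps_ratr R (kneading_det (ord0 : 'I_(nturn F).+1)).
pose E := fps_ratr R (\det (kneading_inverse F)).
pose H := fps_ratr R (ell_ser F * kneading_det (ord0 : 'I_(nturn F).+1)).
pose L : fps (cplx R) := Fps (fun m => (ell F m.+1)%:R).
have DE : D * E = 1 by rewrite -rmorphM kneading_det_inverse // rmorph1.
have D0 := coefs0_neq0 DE.
have cD : sconv (s0 F) D := rconv_D n0.
have cH : sconv (s0 F) H := rconv_ell_det n0.
have cE : sconv (s F) E := rconv_det_inverse n0 ls.
have LE : fps_ratr R (ell_ser F) = L by apply: fpsP => m /=; rewrite rmorph_nat.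
have cL : sconv (s F) L by rewrite -LE; exact: rconv_ell.
have LD : L * D = H by rewrite -LE -rmorphM.
have u_ge := ell_ge n0 ls.
have discs t : disc (s F)^-1%:E t = indisc (s F) t.
  rewrite -(disc_indisc t (ltW s_0)); congr (disc _ t).
  by rewrite inver gt_eqF.
have discs0 t := disc_indisc t s0_0.
split.
  exists (quot (s0 F) D H); split.
  - move=> t; rewrite discs => dt.
    rewrite (quot_extends s0_0 ls DE cD cH cE cL LD dt).
    exact: (ceval_cvg (ltW s_0) cL dt).
  - by move=> t; rewrite discs0 => dt; apply: (quot_meromorphic s0_0 DE D0 cD cH dt).
  - exact: (quot_pole_inv s0_0 ls DE D0 cD cH cL LD u_ge).
move=> j; rewrite (kneading_det_indep n0 j) /=; split.
- move=> t; rewrite discs0 => dt; exact: (cvgP _ (ceval_cvg s0_0 cD dt)).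
- exact: (D_root s0_0 ls DE cD cH cL LD u_ge).
- by move=> t; rewrite discs => dt; apply: (D_neq0 s0_0 ls DE cD cE dt).
Qed.
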